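(* Let $\Bbbk$ be a field. The map $\delta^c=(c\otimes c)\circ\delta\circ c$ restricts to a coproduct on $H^c$, and $(H^c,\mu^c,\Delta^c,\delta^c)$ is a double bialgebra. Likewise, the map $\delta^{cd}=(c\circ d\otimes c\circ d)\circ\delta\circ(c\circ d)$ restricts to a coproduct on $H^{cd}$, and $(H^{cd},\mu^c,\Delta^{cd},\delta^{cd})$ is a double bialgebra.
   Context: A hypergraph $(E,V)$ is a map of sets $h:E\to P(V)$, with $P(V)$ the power set of $V$; elements of $E$ are edges, elements of $V$ are vertices. No restriction is put on $h$: edges may be empty, distinct edges may have the same vertex set. $H$ is the $\Bbbk$-vector space with basis the isomorphism classes of hypergraphs with $E$ and $V$ finite. The complement of $h:E\to P(V)$ is $h^c:E\to P(V)$, $h^c(e)=V\setminus h(e)$. The dual is $h^d:V\to P(E)$, $h^d(v)=\{e\in E: v\in h(e)\}$ (edges and vertices exchange roles). These induce commuting linear involutions $c$ and $d$ of $H$. Product $\mu$ on $H$: disjoint union $(E,V,h)\cdot(E',V',h')=(E\sqcup E',V\sqcup V',h\sqcup h')$, with unit $\eta:1\mapsto(\emptyset,\emptyset)$. Product $\mu^c=c\circ\mu\circ(c\otimes c)$, with the same unit. $\Delta(E,V)=\sum_{U\subseteq V}(E_{|U},U)\otimes(E_{|U^c},U^c)$ where $E_{|U}=\{e\in E:h(e)\subseteq U\}$, $U^c=V\setminus U$; counit $\epsilon_\Delta(E,V)=1$ if $V=\emptyset$, $0$ otherwise. $\Delta^c=(c\otimes c)\circ\Delta\circ c$ and $\Delta^{cd}=(d\circ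 c\otimes d\circ c)\circ\Delta\circ(d\circ c)$. $\delta:H\to H\otimes H$, $\delta(E,V)=\sum_{F\subseteq E^*}(F,V)\otimes(F^c,V/F)$, where $E^*$ is the set of non-empty edges, $F^c=E\setminus F$, $V/F$ is the quotient of $V$ by the equivalence relation generated by $u\sim u'$ if $u,u'$ lie on a common edge of $F$, and $(F^c,V/F)$ is given by $F^c\subseteq E\to P(V)\to P(V/F)$ (direct image). $H^c\subseteq H$ is the subspace spanned by hypergraphs in which no edge contains all the vertices; $H^{cd}\subseteq H$ is the subspace spanned by hypergraphs in which no vertex is contained in all edges. (These are the images under $c$ and $c\circ d$ of the span of hypergraphs without empty edges.) The counits: for $\Delta^c$ it is $1$ if $V=\emptyset$ and $0$ otherwise; for $\delta^c$ it is $1$ if $E=\emptyset$ and $0$ otherwise; for $\Delta^{cd}$ it is $1$ if $E=\emptyset$ and $0$ otherwise; for $\delta^{cd}$ it is $1$ if $V=\emptyset$ and $0$ otherwise. Double bialgebra: $(B,\mu,\Delta,\delta)$ such that $(B,\mu,\Delta)$ and $(B,\mu,\delta)$ are bialgebras (same product and unit $\eta$, counits $\epsilon_\Delta$, $\epsilon_\delta$) and $(\mathrm{id}\otimes\epsilon_\Delta)\circ\delta=\eta\circ\epsilon_\Delta$ and $(\mathrm{id}\otimes\Delta)\circ\delta=m_{13,2,4}\circ(\delta\otimes\delta)\circ\Delta$, where $m_{13,2,4}(a\otimes b\otimes a'\otimes b')=aa'\otimes b\otimes b'$ (product $aa'$ taken in $B$). *)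

(* Defs.v *)
From HB Require Import structures.
From mathcomp Require Import all_boot all_algebra.
From mathcomp Require Import finmap boolp.
From mathcomp.multinomials Require Import monalg.

Set Implicit Arguments.
Unset Strict Implicit.
Unset Printing Implicit Defensive.

Import GRing.Theory.
Local Open Scope ring_scope.
Local Open Scope quotient_scope.

Section Span.
Variables (K : fieldType) (V : lmodType K) (P : V -> Prop).

Definition in_span (x : V) : Prop :=
  exists n (a : 'I_n -> K) (v : 'I_n -> V),
    (forall i, P (v i)) /\ x = \sum_(i < n) a i *: v i.

Definition span_pred : {pred V} := fun x => `[< in_span x >].

Lemma span_predP x : reflect (in_span x) (x \in span_pred).
Proof. exact: asboolP. Qed.

Lemma span_gen x : P x -> x \in span_pred.
Proof.
move=> Px; apply/span_predP; exists 1%N, (fun=> 1), (fun=> x); split=> //.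
by rewrite big_ord1 scale1r.
Qed.

Lemma span_submod_closed : submod_closed span_pred.
Proof.
split.
  apply/span_predP; exists 0%N, (fun=> 0), (fun=> 0).
  by split; [case | rewrite big_ord0].
move=> a x y /span_predP[m [b [u [Pu ->]]]] /span_predP[n [c [v [Pv ->]]]].
apply/span_predP; exists (m + n)%N.
exists (fun i => match split i with inl j => a * b j | inr j => c j end).
exists (fun i => match split i with inl j => u j | inr j => v j end).
split=> [i|]; first by case: (split i).
rewrite big_split_ord /= scaler_sumr; congr (_ + _); apply: eq_bigr => i _.
  by rewrite (unsplitK (inl i)) scalerA.
by rewrite (unsplitK (inr i)).
Qed.

HB.instance Definition _ :=
  GRing.isSubmodClosed.Build K V span_pred span_submod_closed.

Record spanned : predArgType :=
  Span { span_val : V; span_valP : span_val \in span_pred }.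

HB.instance Definition _ := [isSub for span_val].
HB.instance Definition _ := [Choice of spanned by <:].
HB.instance Definition _ := [SubChoice_isSubLmodule of spanned by <:].

End Span.

HB.lock Definition linext (K : fieldType) (I : choiceType) (W : lmodType K)
    (f : I -> W) (x : {malg K[I]}) : W :=
  \sum_(i <- msupp x) x@_i *: f i.

Section LinearExtension.
Variables (K : fieldType) (I : choiceType) (W : lmodType K) (f : I -> W).
Local Notation linext := (linext f).

Lemma linextEw (x : {malg K[I]}) (A : {fset I}) :
  (msupp x `<=` A)%fset -> linext x = \sum_(i <- A) x@_i *: f i.
Proof.
move=> sxA; rewrite linext.unlock (big_fset_incl _ sxA) //= => i _ xi.
by rewrite (mcoeff_outdom xi) scale0r.
Qed.

Lemma linext_is_linear : linear linext.
Proof.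
move=> a x y; set A := (msupp x `|` msupp y `|` msupp (a *: x + y))%fset.
have sxA : (msupp x `<=` A)%fset by rewrite /A -fsetUA fsubsetUl.
have syA : (msupp y `<=` A)%fset by rewrite /A fsetUAC fsubsetUr.
have szA : (msupp (a *: x + y) `<=` A)%fset by rewrite /A fsubsetUr.
rewrite (linextEw sxA) (linextEw syA) (linextEw szA) scaler_sumr -big_split.
by apply: eq_bigr => i _; rewrite mcoeffD mcoeffZ scalerDl scalerA.
Qed.

HB.instance Definition _ :=
  GRing.isLinear.Build K {malg K[I]} W *:%R linext linext_is_linear.

Lemma linextU i : linext << i >> = f i.
Proof.
by rewrite (linextEw msuppU_le) big_seq_fset1 mcoeffUU scale1r.
Qed.

End LinearExtension.

Lemma malg_linear_ext (K : fieldType) (I : choiceType) (W : lmodType K)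
    (f g : {linear {malg K[I]} -> W}) :
  (forall i, f << i >> = g << i >>) -> f =1 g.
Proof.
move=> fg x; rewrite [x]monalgE !raddf_sum; apply: eq_bigr => i _ /=.
suff -> : << x@_i *g i >> = x@_i *: << i >> :> {malg K[I]}.
  by rewrite !linearZ fg.
by apply/malgP => j; rewrite mcoeffZ !mcoeffU mulr_natr.
Qed.

Section Tensor.
Variables (K : fieldType) (U V : lmodType K).

Definition tensor_relation (x : {malg K[(U * V)%type]}) : Prop :=
  (exists a u u' v,
     x = << (a *: u + u', v) >> - (a *: << (u, v) >> + << (u', v) >>))
  \/ (exists a u v v',
     x = << (u, a *: v + v') >> - (a *: << (u, v) >> + << (u, v') >>)).

Definition tensor : Type := Quotient.quot (span_pred tensor_relation).

HB.instance Definition _ := GRing.Zmodule.on tensor.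

Definition tensor_pi (x : {malg K[(U * V)%type]}) : tensor :=
  \pi_(Quotient.quot (span_pred tensor_relation)) x.
Definition tensor_repr (t : tensor) : {malg K[(U * V)%type]} :=
  repr (t : Quotient.quot (span_pred tensor_relation)).

Lemma tensor_reprK : cancel tensor_repr tensor_pi.
Proof. by move=> t; rewrite /tensor_pi /tensor_repr reprK. Qed.

Lemma tensor_piD : {morph tensor_pi : x y / x + y}.
Proof. by move=> x y; rewrite /tensor_pi Quotient.pi_add. Qed.

Lemma tensor_pi_eq x y :
  (tensor_pi x == tensor_pi y) = (x - y \in span_pred tensor_relation).
Proof. by rewrite Quotient.idealrBE. Qed.

Definition tensor_scale (a : K) (t : tensor) : tensor :=
  tensor_pi (a *: tensor_repr t).

Lemma tensor_piZ a x : tensor_scale a (tensor_pi x) = tensor_pi (a *: x).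
Proof.
apply/eqP; rewrite tensor_pi_eq -scalerBr rpredZ //.
by rewrite -tensor_pi_eq tensor_reprK.
Qed.

Lemma tensor_scaleA a b t :
  tensor_scale a (tensor_scale b t) = tensor_scale (a * b) t.
Proof. by rewrite -[t]tensor_reprK !tensor_piZ scalerA. Qed.

Lemma tensor_scale1 : left_id 1 tensor_scale.
Proof. by move=> t; rewrite -[t]tensor_reprK !tensor_piZ scale1r. Qed.

Lemma tensor_scaleDr : right_distributive tensor_scale +%R.
Proof.
move=> a s t; rewrite -[s]tensor_reprK -[t]tensor_reprK.
by rewrite -tensor_piD !tensor_piZ scalerDr tensor_piD.
Qed.

Lemma tensor_scaleDl t : {morph tensor_scale^~ t : a b / a + b}.
Proof.
by move=> a b; rewrite -[t]tensor_reprK !tensor_piZ scalerDl tensor_piD.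
Qed.

HB.instance Definition _ := GRing.Zmodule_isLmodule.Build K tensor
  tensor_scaleA tensor_scale1 tensor_scaleDr tensor_scaleDl.

Lemma tensor_pi_is_linear : linear tensor_pi.
Proof. by move=> a x y; rewrite tensor_piD -tensor_piZ. Qed.

HB.instance Definition _ :=
  GRing.isLinear.Build K {malg K[(U * V)%type]} tensor *:%R tensor_pi
    tensor_pi_is_linear.

End Tensor.

Arguments tensor {K} (U V).

HB.lock Definition tens (K : fieldType) (U V : lmodType K) (u : U) (v : V) :
  tensor U V := tensor_pi << (u, v) >>.

(* The universal property of the tensor product is tliftE and tensor_ext. *)
HB.lock Definition tlift (K : fieldType) (U V W : lmodType K)
    (f : {bilinear U -> V -> W}) (t : tensor U V) : W :=
  linext (fun p : U * V => f p.1 p.2) (tensor_repr t).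

Section TensorTheory.
Variables (K : fieldType) (U V : lmodType K).
Local Notation tensor := (tensor U V).
Local Notation tens := (@tens K U V).

Lemma tens_is_bilinear : bilinear_for *:%R *:%R tens.
Proof.
split=> [v a u u'|u a v v'] /=; rewrite tens.unlock -linearP;
  apply/eqP; rewrite tensor_pi_eq span_gen //; [left|right].
- by exists a, u, u', v.
- by exists a, u, v, v'.
Qed.

HB.instance Definition _ :=
  bilinear_isBilinear.Build K U V tensor *:%R *:%R tens tens_is_bilinear.

Lemma tensPl a u u' v : tens (a *: u + u') v = a *: tens u v + tens u' v.
Proof. exact: tens_is_bilinear.1. Qed.

Lemma tensPr u a v v' : tens u (a *: v + v') = a *: tens u v + tens u v'.
Proof. exact: tens_is_bilinear.2. Qed.

Lemma tensor_ext (W : lmodType K) (f g : {linear tensor -> W}) :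
  (forall u v, f (tens u v) = g (tens u v)) -> f =1 g.
Proof.
move=> fg t; rewrite -[t]tensor_reprK.
apply: (malg_linear_ext (f := f \o @tensor_pi K U V) (g := g \o @tensor_pi K U V)).
by move=> [u v] /=; move: (fg u v); rewrite tens.unlock.
Qed.

Section Lift.
Variables (W : lmodType K) (f : {bilinear U -> V -> W}).

Local Notation tlift := (tlift f).

Lemma linext_relation x : x \in span_pred (@tensor_relation K U V) ->
  linext (fun p => f p.1 p.2) x = 0.
Proof.
move=> /span_predP[n [a [v [Pv ->]]]]; rewrite raddf_sum big1 // => i _ /=.
rewrite linearZ /=; suff -> : linext (fun p => f p.1 p.2) (v i) = 0.
  by rewrite scaler0.
case: (Pv i) => -[b [u [u' [w ->]]]].
  by rewrite linearB linearP /= !linextU /= linearPl subrr.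
by rewrite linearB linearP /= !linextU /= linearPr subrr.
Qed.

Lemma tlift_pi x : tlift (tensor_pi x) = linext (fun p => f p.1 p.2) x.
Proof.
apply/eqP; rewrite -subr_eq0 tlift.unlock -linearB; apply/eqP/linext_relation.
by rewrite -tensor_pi_eq tensor_reprK.
Qed.

Lemma tlift_is_linear : linear tlift.
Proof.
move=> a s t; rewrite -[s]tensor_reprK -[t]tensor_reprK.
by rewrite -linearP !tlift_pi linearP.
Qed.

HB.instance Definition _ :=
  GRing.isLinear.Build K tensor W *:%R tlift tlift_is_linear.

Lemma tliftE u v : tlift (tens u v) = f u v.
Proof. by rewrite tens.unlock tlift_pi linextU. Qed.

End Lift.
End TensorTheory.

Notation "U ⊗ V" := (tensor U V) (at level 40, left associativity) : ring_scope.
Notation "u \ox v" := (tens u v) (at level 40, left associativity) : ring_scope.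

Section TensorMap.
Variables (K : fieldType) (U V U' V' : lmodType K).
Variables (f : {linear U -> U'}) (g : {linear V -> V'}).

Definition tmap_fun (u : U) (v : V) : U' ⊗ V' := f u \ox g v.

Lemma tmap_is_bilinear : bilinear_for *:%R *:%R tmap_fun.
Proof.
split=> [v a u u'|u a v v'] /=; rewrite /tmap_fun linearP.
  exact: tensPl.
exact: tensPr.
Qed.

HB.instance Definition _ := bilinear_isBilinear.Build K U V (U' ⊗ V')
  *:%R *:%R tmap_fun tmap_is_bilinear.

Definition tmap : U ⊗ V -> U' ⊗ V' := tlift tmap_fun.
HB.instance Definition _ := GRing.Linear.on tmap.

Lemma tmapE u v : tmap (u \ox v) = f u \ox g v.
Proof. exact: tliftE. Qed.

End TensorMap.

(* The identifications K ⊗ V = V, V ⊗ K = V, (A ⊗ B) ⊗ C = A ⊗ (B ⊗ C) and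
   the exchange of the two middle factors of (A ⊗ B) ⊗ (C ⊗ D). *)
Section Unitors.
Variables (K : fieldType) (V : lmodType K).

Definition tunitl_fun (a : K^o) (v : V) : V := a *: v.
Definition tunitr_fun (v : V) (a : K^o) : V := a *: v.

Lemma tunitl_is_bilinear : bilinear_for *:%R *:%R tunitl_fun.
Proof.
split=> [v a b c|b a v w]; rewrite /tunitl_fun.
  by rewrite scalerDl -[in LHS]scalerA.
by rewrite scalerDr (scalerA b a v) (mulrC b a) -(scalerA a b v).
Qed.

Lemma tunitr_is_bilinear : bilinear_for *:%R *:%R tunitr_fun.
Proof.
split=> [b a v w|v a b c]; rewrite /tunitr_fun.
  by rewrite scalerDr (scalerA b a v) (mulrC b a) -(scalerA a b v).
by rewrite scalerDl -[in LHS]scalerA.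
Qed.

HB.instance Definition _ := bilinear_isBilinear.Build K K^o V V
  *:%R *:%R tunitl_fun tunitl_is_bilinear.
HB.instance Definition _ := bilinear_isBilinear.Build K V K^o V
  *:%R *:%R tunitr_fun tunitr_is_bilinear.

Definition tunitl : K^o ⊗ V -> V := tlift tunitl_fun.
HB.instance Definition _ := GRing.Linear.on tunitl.

Definition tunitr : V ⊗ K^o -> V := tlift tunitr_fun.
HB.instance Definition _ := GRing.Linear.on tunitr.

Lemma tunitlE a v : tunitl (a \ox v) = a *: v.
Proof. exact: tliftE. Qed.

Lemma tunitrE v a : tunitr (v \ox a) = a *: v.
Proof. exact: tliftE. Qed.

End Unitors.

Section Associator.
Variables (K : fieldType) (A B C : lmodType K).

Definition tassoc_fun1 (c : C) (a : A) (b : B) : A ⊗ (B ⊗ C) := a \ox (b \ox c).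

Lemma tassoc1_is_bilinear c : bilinear_for *:%R *:%R (tassoc_fun1 c).
Proof.
split=> [b k a a'|a k b b']; rewrite /tassoc_fun1; first exact: tensPl.
by rewrite tensPl tensPr.
Qed.

HB.instance Definition _ c := bilinear_isBilinear.Build K A B (A ⊗ (B ⊗ C))
  *:%R *:%R (tassoc_fun1 c) (tassoc1_is_bilinear c).

Definition tassoc_fun2 (t : A ⊗ B) (c : C) : A ⊗ (B ⊗ C) :=
  tlift (tassoc_fun1 c) t.

Lemma tassoc2_is_bilinear : bilinear_for *:%R *:%R tassoc_fun2.
Proof.
split=> [c k s t|t k c c']; rewrite /tassoc_fun2; first exact: linearP.
apply: (tensor_ext (f := tlift (tassoc_fun1 (k *: c + c')))
  (g := (k \*: tlift (tassoc_fun1 c)) \+ tlift (tassoc_fun1 c'))) => a b /=.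
by rewrite !tliftE /= /tassoc_fun1 !tensPr.
Qed.

HB.instance Definition _ := bilinear_isBilinear.Build K (A ⊗ B) C (A ⊗ (B ⊗ C))
  *:%R *:%R tassoc_fun2 tassoc2_is_bilinear.

Definition tassoc : (A ⊗ B) ⊗ C -> A ⊗ (B ⊗ C) := tlift tassoc_fun2.
HB.instance Definition _ := GRing.Linear.on tassoc.

Lemma tassocE a b c : tassoc ((a \ox b) \ox c) = a \ox (b \ox c).
Proof. by rewrite /tassoc tliftE /= /tassoc_fun2 tliftE. Qed.

End Associator.

Section Interchange.
Variables (K : fieldType) (A B C D : lmodType K).
Local Notation W := ((A ⊗ C) ⊗ (B ⊗ D)).

Definition tinter_fun1 (a : A) (b : B) (c : C) (d : D) : W :=
  (a \ox c) \ox (b \ox d).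

Lemma tinter1_is_bilinear a b : bilinear_for *:%R *:%R (tinter_fun1 a b).
Proof.
split=> [d k c c'|c k d d']; rewrite /tinter_fun1.
  by rewrite tensPr tensPl.
by rewrite 2!tensPr.
Qed.

HB.instance Definition _ a b := bilinear_isBilinear.Build K C D W
  *:%R *:%R (tinter_fun1 a b) (tinter1_is_bilinear a b).

Definition tinter_fun2 (s : C ⊗ D) (a : A) (b : B) : W :=
  tlift (tinter_fun1 a b) s.

Lemma tinter2_is_bilinear s : bilinear_for *:%R *:%R (tinter_fun2 s).
Proof.
split=> [b k a a'|a k b b']; rewrite /tinter_fun2.
  apply: (tensor_ext (f := tlift (tinter_fun1 (k *: a + a') b))
    (g := (k \*: tlift (tinter_fun1 a b)) \+ tlift (tinter_fun1 a' b))) => c d.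
  by rewrite /= !tliftE /= /tinter_fun1 !tensPl.
apply: (tensor_ext (f := tlift (tinter_fun1 a (k *: b + b')))
  (g := (k \*: tlift (tinter_fun1 a b)) \+ tlift (tinter_fun1 a b'))) => c d.
by rewrite /= !tliftE /= /tinter_fun1 tensPl tensPr.
Qed.

HB.instance Definition _ s := bilinear_isBilinear.Build K A B W
  *:%R *:%R (tinter_fun2 s) (tinter2_is_bilinear s).

Definition tinter_fun3 (t : A ⊗ B) (s : C ⊗ D) : W := tlift (tinter_fun2 s) t.

Lemma tinter3_is_bilinear : bilinear_for *:%R *:%R tinter_fun3.
Proof.
split=> [s k t t'|t k s s']; rewrite /tinter_fun3; first exact: linearP.
apply: (tensor_ext (f := tlift (tinter_fun2 (k *: s + s')))
  (g := (k \*: tlift (tinter_fun2 s)) \+ tlift (tinter_fun2 s'))) => a b.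
by rewrite /= !tliftE /= /tinter_fun2 linearP.
Qed.

HB.instance Definition _ := bilinear_isBilinear.Build K (A ⊗ B) (C ⊗ D) W
  *:%R *:%R tinter_fun3 tinter3_is_bilinear.

Definition tinter : (A ⊗ B) ⊗ (C ⊗ D) -> (A ⊗ C) ⊗ (B ⊗ D) :=
  tlift tinter_fun3.
HB.instance Definition _ := GRing.Linear.on tinter.

Lemma tinterE a b c d : tinter ((a \ox b) \ox (c \ox d)) = (a \ox c) \ox (b \ox d).
Proof. by rewrite /tinter tliftE /= /tinter_fun3 tliftE /= /tinter_fun2 tliftE. Qed.

End Interchange.

Section DoubleBialgebra.
Variables (K : fieldType) (B : lmodType K).
Variables (mu : {linear B ⊗ B -> B}) (eta : {linear K^o -> B}).

Definition unital_algebra : Prop :=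
  (forall x y z : B, mu (mu (x \ox y) \ox z) = mu (x \ox mu (y \ox z))) /\
  (forall x : B, mu (eta 1 \ox x) = x /\ mu (x \ox eta 1) = x).

Definition counital_coalgebra
    (Delta : {linear B -> B ⊗ B}) (eps : {linear B -> K^o}) : Prop :=
  (forall x : B,
     tassoc (tmap Delta idfun (Delta x)) = tmap idfun Delta (Delta x)) /\
  (forall x : B, tunitl (tmap eps idfun (Delta x)) = x /\
                 tunitr (tmap idfun eps (Delta x)) = x).

Definition bialgebra
    (Delta : {linear B -> B ⊗ B}) (eps : {linear B -> K^o}) : Prop :=
  [/\ unital_algebra,
      counital_coalgebra Delta eps,
      Delta (eta 1) = eta 1 \ox eta 1 /\
        (forall x y : B,
           Delta (mu (x \ox y)) = tmap mu mu (tinter (Delta x \ox Delta y)))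
    & eps (eta 1) = 1 /\ (forall x y : B, eps (mu (x \ox y)) = eps x * eps y)].

(* a ⊗ b ⊗ a' ⊗ b' is sent to a a' ⊗ b ⊗ b'. *)
Definition m13_2_4 (t : (B ⊗ B) ⊗ (B ⊗ B)) : B ⊗ (B ⊗ B) :=
  tmap mu idfun (tinter t).

Definition double_bialgebra
    (Delta : {linear B -> B ⊗ B}) (epsDelta : {linear B -> K^o})
    (delta : {linear B -> B ⊗ B}) (epsdelta : {linear B -> K^o}) : Prop :=
  [/\ bialgebra Delta epsDelta,
      bialgebra delta epsdelta,
      forall x : B, tunitr (tmap idfun epsDelta (delta x)) = eta (epsDelta x)
    & forall x : B,
        tmap idfun Delta (delta x) = m13_2_4 (tmap delta delta (Delta x))].

End DoubleBialgebra.

Record hypergraph : Type := Hypergraph {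
  edges : finType;
  verts : finType;
  inc : edges -> {set verts}
}.

Definition hiso (G G' : hypergraph) : Prop :=
  exists (f : edges G -> edges G') (g : verts G -> verts G'),
    [/\ bijective f, bijective g & forall e, inc (f e) = g @: inc e].

Lemma hiso_refl G : hiso G G.
Proof.
exists id, id; split; [by exists id | by exists id |].
by move=> e; rewrite imset_id.
Qed.

Lemma hiso_sym G G' : hiso G G' -> hiso G' G.
Proof.
move=> [f [g [[f' fK f'K] [g' gK g'K] fg]]]; exists f', g'.
split; [by exists f | by exists g |] => e.
rewrite -{2}[e]f'K fg -imset_comp (eq_imset _ gK) imset_id //.
Qed.

Lemma hiso_trans G G' G'' : hiso G G' -> hiso G' G'' -> hiso G G''.
Proof.
move=> [f [g [bf bg fg]]] [f' [g' [bf' bg' fg']]].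
exists (f' \o f), (g' \o g); split; [exact: bij_comp | exact: bij_comp |].
by move=> e /=; rewrite fg' fg imset_comp.
Qed.

Section Operations.
Variable G : hypergraph.

Definition hcompl : hypergraph := Hypergraph (fun e : edges G => ~: inc e).

Definition hdual : hypergraph :=
  Hypergraph (fun v : verts G => [set e | v \in inc e]).

Definition hrestr (U : {set verts G}) : hypergraph :=
  @Hypergraph {e : edges G | inc e \subset U} {v : verts G | v \in U}
    (fun e => [set v | val v \in inc (val e)]).

Section Quotient.
Variable F : {set edges G}.

Definition hsub : hypergraph :=
  @Hypergraph {e : edges G | e \in F} (verts G) (fun e => inc (val e)).

Definition adjacent : rel (verts G) :=
  fun u u' => [exists e in F, (u \in inc e) && (u' \in inc e)].

(* adjacent is symmetric, so its reflexive transitive closure connect is the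
   equivalence relation it generates. *)
Definition vclass (v : verts G) : {set verts G} :=
  [set w | connect adjacent v w].

Definition vquot : finType :=
  {A : {set verts G} | A \in [set vclass v | v : verts G]}.

Fact vclass_in_vquot v : vclass v \in [set vclass v | v : verts G].
Proof. exact: imset_f. Qed.

Definition vproj (v : verts G) : vquot := exist _ (vclass v) (vclass_in_vquot v).

Definition hcontract : hypergraph :=
  @Hypergraph {e : edges G | e \in ~: F} vquot (fun e => vproj @: inc (val e)).

End Quotient.

Definition nonempty_edges : {set edges G} := [set e | inc e != set0].

End Operations.

Definition hunion (G G' : hypergraph) : hypergraph :=
  @Hypergraph (edges G + edges G')%type (verts G + verts G')%type
    (fun e => match e with
              | inl e => [set inl v | v in inc e]
              | inr e => [set inr v | v in inc e]
              end).

Definition hempty : hypergraph := @Hypergraph void void (fun=> set0).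

(* Isomorphism classes.  Every finite hypergraph is isomorphic to one with
   edges 'I_m and vertices 'I_n, so the classes are those of such hypergraphs;
   hclassP states that this gives all hypergraphs up to isomorphism. *)
Definition hcode : Type := {mn : nat * nat & {ffun 'I_mn.1 -> {set 'I_mn.2}}}.
HB.instance Definition _ := Choice.on hcode.

Definition of_hcode (x : hcode) : hypergraph :=
  @Hypergraph 'I_(tag x).1 'I_(tag x).2 (tagged x).

Definition to_hcode (G : hypergraph) : hcode :=
  existT (fun mn : nat * nat => {ffun 'I_mn.1 -> {set 'I_mn.2}})
    (#|edges G|, #|verts G|)
    [ffun i : 'I_#|edges G| => [set enum_rank v | v in inc (enum_val i)]].

Definition hcode_iso : rel hcode :=
  fun x y => `[< hiso (of_hcode x) (of_hcode y) >].

Lemma hcode_iso_equiv : equiv_class_of hcode_iso.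
Proof.
split=> [x|x y|y x z].
- by apply/asboolP/hiso_refl.
- by apply/asboolP/asboolP; apply: hiso_sym.
- by move=> /asboolP xy /asboolP yz; apply/asboolP/(hiso_trans xy yz).
Qed.

Canonical hcode_iso_equivRel := EquivRelPack hcode_iso_equiv.
Canonical hcode_iso_encModRel := defaultEncModRel hcode_iso.

Definition hclass : Type := {eq_quot hcode_iso}.
HB.instance Definition _ := Choice.on hclass.

Definition hclass_of (G : hypergraph) : hclass :=
  \pi_({eq_quot hcode_iso}) (to_hcode G).

Definition hrepr (x : hclass) : hypergraph :=
  of_hcode (repr (x : {eq_quot hcode_iso})).

Lemma hiso_to_hcode G : hiso G (of_hcode (to_hcode G)).
Proof.
exists enum_rank, enum_rank; split; [exact: enum_rank_bij.. |] => e.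
by rewrite /= ffunE enum_rankK.
Qed.

Lemma hclassP G G' : hclass_of G = hclass_of G' <-> hiso G G'.
Proof.
have iG := hiso_to_hcode G; have iG' := hiso_to_hcode G'.
split=> [/eqP|iGG'].
  rewrite eqmodE => /asboolP i; apply: hiso_trans iG _.
  exact: hiso_trans i (hiso_sym iG').
apply/eqP; rewrite eqmodE; apply/asboolP.
exact: hiso_trans (hiso_sym iG) (hiso_trans iGG' iG').
Qed.

Lemma hreprK : cancel hrepr hclass_of.
Proof.
move=> x; rewrite -[RHS](reprK (x : {eq_quot hcode_iso})).
by apply/eqP; rewrite eqmodE; apply/asboolP/hiso_sym/hiso_to_hcode.
Qed.

(* The operations on H are defined on a basis element by applying the formula
   to the chosen representative hrepr x of the isomorphism class x; the formulas
   are invariant under isomorphism, so the choice does not matter. *)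
Section HypergraphSpace.
Variable K : fieldType.

Definition H : Type := {malg K[hclass]}.
HB.instance Definition _ := GRing.Lmodule.on H.

Definition hg (G : hypergraph) : H := << hclass_of G >>.

Definition c_map : H -> H := linext (fun x => hg (hcompl (hrepr x))).
HB.instance Definition _ := GRing.Linear.on c_map.

Definition d_map : H -> H := linext (fun x => hg (hdual (hrepr x))).
HB.instance Definition _ := GRing.Linear.on d_map.

Definition hmul (a b : H) : H :=
  linext (fun x => linext (fun y => hg (hunion (hrepr x) (hrepr y))) b) a.

Lemma hmul_is_bilinear : bilinear_for *:%R *:%R hmul.
Proof.
split=> [b k a a'|a k b b']; rewrite /hmul; first exact: linearP.
apply: (malg_linear_ext (f := linext _)
  (g := (k \*: linext (fun x => linext _ b)) \+ linext (fun x => linext _ b'))).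
by move=> x /=; rewrite !linextU linearP.
Qed.

HB.instance Definition _ :=
  bilinear_isBilinear.Build K H H H *:%R *:%R hmul hmul_is_bilinear.

Definition mu_H : H ⊗ H -> H := tlift hmul.
HB.instance Definition _ := GRing.Linear.on mu_H.

Definition eta_H (a : K^o) : H := a *: hg hempty.

Definition Delta_H : H -> H ⊗ H := linext (fun x =>
  \sum_(U : {set verts (hrepr x)}) hg (hrestr U) \ox hg (hrestr (~: U))).
HB.instance Definition _ := GRing.Linear.on Delta_H.

Definition delta_H : H -> H ⊗ H := linext (fun x =>
  \sum_(F : {set edges (hrepr x)} | F \subset nonempty_edges (hrepr x))
     hg (hsub F) \ox hg (hcontract F)).
HB.instance Definition _ := GRing.Linear.on delta_H.

Definition eps_verts : H -> K^o :=
  linext (fun x => (#|verts (hrepr x)| == 0%N)%:R : K^o).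
HB.instance Definition _ := GRing.Linear.on eps_verts.

Definition eps_edges : H -> K^o :=
  linext (fun x => (#|edges (hrepr x)| == 0%N)%:R : K^o).
HB.instance Definition _ := GRing.Linear.on eps_edges.

Definition mu_c : H ⊗ H -> H := c_map \o mu_H \o tmap c_map c_map.

Definition Delta_c : H -> H ⊗ H := tmap c_map c_map \o Delta_H \o c_map.
Definition delta_c : H -> H ⊗ H := tmap c_map c_map \o delta_H \o c_map.

Definition Delta_cd : H -> H ⊗ H :=
  tmap (d_map \o c_map) (d_map \o c_map) \o Delta_H \o (d_map \o c_map).
Definition delta_cd : H -> H ⊗ H :=
  tmap (c_map \o d_map) (c_map \o d_map) \o delta_H \o (c_map \o d_map).

Definition Hc : Type := spanned (fun x : H =>
  exists G : hypergraph,
    ~ (exists e : edges G, forall v, v \in inc e) /\ x = hg G).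
HB.instance Definition _ := GRing.Lmodule.on Hc.

Definition Hcd : Type := spanned (fun x : H =>
  exists G : hypergraph,
    ~ (exists v : verts G, forall e, v \in inc e) /\ x = hg G).
HB.instance Definition _ := GRing.Lmodule.on Hcd.

Definition incl_c : Hc -> H := @span_val _ _ _.
Definition incl_cd : Hcd -> H := @span_val _ _ _.

Lemma incl_c_is_linear : linear incl_c.
Proof. by []. Qed.
Lemma incl_cd_is_linear : linear incl_cd.
Proof. by []. Qed.

HB.instance Definition _ :=
  GRing.isLinear.Build K Hc H *:%R incl_c incl_c_is_linear.
HB.instance Definition _ :=
  GRing.isLinear.Build K Hcd H *:%R incl_cd incl_cd_is_linear.

End HypergraphSpace.

(* Main.v *)
Require Import Defs.
From HB Require Import structures.
From mathcomp Require Import all_boot all_algebra.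
From mathcomp Require Import finmap.
From mathcomp.multinomials Require Import monalg.

Set Implicit Arguments.
Unset Strict Implicit.
Unset Printing Implicit Defensive.

Import GRing.Theory.
Local Open Scope ring_scope.

(* Every operation is computed inside one ambient hypergraph [G].  A minor of
   [G] contracts a set [F] of edges and then keeps the edges of a set [A] and
   the vertices coming from a union [U] of classes; it is determined up to
   isomorphism by [F], [A] and [U], and restrictions, sub-hypergraphs,
   contractions and disjoint unions of minors are again minors.  When no edge is
   empty, an edge lies in at most one of two disjoint vertex sets, and every
   axiom of a double bialgebra becomes the reindexing of a sum over sets of
   edges and of vertices.  This applies verbatim to any family [b G] spanning a
   vector space on which the operations satisfy the formulas of the hypergraphs
   without empty edges: for [H^c] take the complements, and for [H^cd] the duals
   of the complements, where [mu^c] is again the right product because duality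
   commutes with disjoint unions. *)

(** * Connectedness and minors *)

(** The composites in the axioms live on nested subtypes and quotient types: a quotient of a
    quotient, a restriction of a contraction, a contraction of a disjoint union. Comparing them
    directly would need a new explicit isomorphism each time. A minor is instead named by three sets
    over fixed ambient types, so two composites agree as soon as these sets do. The same minor may
    still be named by several contracted sets: the classes lying in [U] do not change when [F] gains
    edges that avoid [U]. This freedom is essential, since disjoint unions are only formed between
    minors with the same contracted set, while the factors of a product of contractions contract
    different sets. Empty edges have to be excluded because [delta] never contracts them: an empty
    edge would survive in every right-hand factor, and the counit law on that side would fail. *)

Section Saturation.
Variable G : hypergraph.
Implicit Types (F A B : {set edges G}) (U C : {set verts G}) (u v : verts G).

(** No edge of [F] crosses the boundary of [C]. These are the unions of classes of the relation
    generated by [F], described without paths, which makes Boolean operations on them immediate. *)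
Definition saturated F C :=
  [forall e in F, (inc e \subset C) || (inc e \subset ~: C)].

Lemma saturatedP F C :
  reflect (forall e u v, e \in F -> u \in inc e -> v \in inc e ->
             u \in C -> v \in C)
          (saturated F C).
Proof.
apply: (iffP forall_inP) => [satC e u v Fe ue ve uC|satC e Fe].
  case/orP: (satC e Fe) => /subsetP sub; first exact: sub.
  by move: (sub u ue); rewrite inE uC.
have [eC|[u /setIP[ue uC]]] := set_0Vmem (inc e :&: C).
  by rewrite -disjoints_subset -setI_eq0 eC eqxx orbT.
by apply/orP; left; apply/subsetP => v ve; apply: satC ue ve uC.
Qed.

Lemma saturated0 C : saturated set0 C.
Proof. by apply/saturatedP => e u v; rewrite inE. Qed.

Lemma saturatedT F : saturated F setT.
Proof. by apply/saturatedP => e u v *; rewrite inE. Qed.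

Lemma saturatedC F C : saturated F (~: C) = saturated F C.
Proof. by apply: eq_forallb_in => e _; rewrite setCK orbC. Qed.

Lemma saturatedI F C C' :
  saturated F C -> saturated F C' -> saturated F (C :&: C').
Proof.
move=> /saturatedP satC /saturatedP satC'; apply/saturatedP => e u v Fe ue ve.
by rewrite !inE => /andP[uC uC']; rewrite (satC e u) // (satC' e u).
Qed.

Lemma saturatedU F C C' :
  saturated F C -> saturated F C' -> saturated F (C :|: C').
Proof.
by move=> ? ?; rewrite -[_ :|: _]setCK saturatedC setCU saturatedI ?saturatedC.
Qed.

Lemma saturatedUl F F' C :
  saturated (F :|: F') C = saturated F C && saturated F' C.
Proof.
apply/forall_inP/andP => [satC|[/forall_inP satC /forall_inP satC'] e].
  by split; apply/forall_inP => e Fe; apply: satC; rewrite inE Fe ?orbT.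
by rewrite inE => /orP[]; [apply: satC | apply: satC'].
Qed.

Lemma saturatedS F F' C : F \subset F' -> saturated F' C -> saturated F C.
Proof. by move=> /setUidPr<-; rewrite saturatedUl => /andP[]. Qed.

Definition conn F := connect (adjacent F).

Lemma conn_sym F u v : conn F u v = conn F v u.
Proof.
apply: sym_connect_sym => x y.
by apply: eq_existsb => e; rewrite [in RHS](andbC (y \in _)).
Qed.

Lemma conn_trans F : transitive (conn F). Proof. exact: connect_trans. Qed.

Lemma conn_refl F : reflexive (conn F). Proof. exact: connect0. Qed.

Lemma conn_saturated F C u v :
  saturated F C -> conn F u v -> (u \in C) = (v \in C).
Proof.
move=> /saturatedP satC; apply: (@closed_connect _ (adjacent F)) => x y.
case/exists_inP=> e Fe /andP[xe ye].
by apply/idP/idP; apply: satC; eassumption.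
Qed.

Lemma conn_edge F e u v : e \in F -> u \in inc e -> v \in inc e -> conn F u v.
Proof.
by move=> Fe ue ve; apply/connect1/exists_inP; exists e; rewrite // ue ve.
Qed.

Lemma saturated_vclass F u : saturated F (vclass F u).
Proof.
apply/saturatedP => e v w Fe ve we; rewrite !inE => uv.
exact: conn_trans uv (conn_edge Fe ve we).
Qed.

(** The class of [u] is the smallest saturated set containing [u]. In this form a connection is
    carried from one hypergraph to another by transporting saturated sets, with no induction on
    paths. *)
Lemma connP F u v :
  reflect (forall C, saturated F C -> u \in C -> v \in C) (conn F u v).
Proof.
apply: (iffP idP) => [uv C satC|/(_ _ (saturated_vclass F u))].
  by rewrite (conn_saturated satC uv).
by rewrite !inE; apply; apply: conn_refl.
Qed.

Lemma connS F F' u v : F \subset F' -> conn F u v -> conn F' u v.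
Proof.
move=> sFF' /connP uv; apply/connP => C satC; apply: uv.
exact: saturatedS satC.
Qed.

Lemma conn0 u v : conn set0 u v = (u == v).
Proof.
apply/connP/eqP => [/(_ [set u] (saturated0 _))|-> //].
by rewrite !inE => /(_ (eqxx _))/eqP.
Qed.

Lemma vclass_eq F u v : (vclass F u == vclass F v) = conn F u v.
Proof.
apply/eqP/idP => [/setP/(_ v)|uv].
  by rewrite !inE /conn => ->; apply: conn_refl.
apply/setP => w; rewrite !inE.
by apply/idP/idP; apply: conn_trans; rewrite // conn_sym.
Qed.

Lemma vproj_eq F u v : (vproj F u == vproj F v) = conn F u v.
Proof. by rewrite -val_eqE vclass_eq. Qed.

Lemma vproj_surj F (x : vquot F) : exists u, vproj F u = x.
Proof. by case: x => A /[dup] /imsetP[u _ ->] ?; exists u; apply: val_inj. Qed.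

End Saturation.

(* [X] is obtained from [G] by contracting [F], then keeping the edges of [A]
   and the vertices that come from [U].  The partial map [q] sends a vertex of
   [U] to its class. *)
Record minor_of (G : hypergraph) (F A : {set edges G}) (U : {set verts G})
    (X : hypergraph) (i : edges X -> edges G) (q : verts G -> option (verts X))
    : Prop := MinorOf {
  minor_sat : saturated F U;
  minor_sub : forall e, e \in A -> inc e \subset U;
  minor_inj : injective i;
  minor_img : i @: setT = A;
  minor_dom : forall v, (v \in U) = isSome (q v);
  minor_surj : forall x, exists v, q v = Some x;
  minor_ker : forall u v, u \in U -> v \in U -> (q u == q v) = conn F u v;
  minor_inc : forall e x,
    x \in inc e <-> exists2 v, v \in inc (i e) & q v = Some x }.

(** Edges of [X] and [Y] are matched through their common image in [A], and vertices through a
    common lift in [U]. The lift exists by surjectivity, and its choice is immaterial because [F]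
    alone decides which lifts are identified. *)
Lemma minor_uniq G F A U X i q Y j r :
  @minor_of G F A U X i q -> @minor_of G F A U Y j r -> hiso X Y.
Proof.
have half X1 i1 q1 X2 i2 q2 : @minor_of G F A U X1 i1 q1 ->
    @minor_of G F A U X2 i2 q2 ->
    exists (f : edges X1 -> edges X2) (g : verts X1 -> verts X2),
      (forall e, i2 (f e) = i1 e) /\
      (forall x, exists v, [/\ v \in U, q1 v = Some x & q2 v = Some (g x)]).
  move=> m1 m2.
  have /fin_all_exists[f fE] : forall e, exists e', i2 e' = i1 e.
    move=> e; have : i1 e \in i2 @: setT.
      by rewrite (minor_img m2) -(minor_img m1) imset_f.
    by case/imsetP=> e' _ ->; exists e'.
  have /fin_all_exists[g gE] : forall x, exists y,
      exists v, [/\ v \in U, q1 v = Some x & q2 v = Some y].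
    move=> x; have [v vx] := minor_surj m1 x.
    have vU : v \in U by rewrite (minor_dom m1) vx.
    move: (vU); rewrite (minor_dom m2); case vy : (q2 v) => [y|//] _.
    by exists y, v.
  by exists f, g.
move=> mX mY; have [f [g [fE gE]]] := half _ _ _ _ _ _ mX mY.
have [f' [g' [f'E g'E]]] := half _ _ _ _ _ _ mY mX.
(* The lift behind [g x] may be replaced by any other: two lifts of [x] are connected by [F], hence
   identified in [Y] as well. *)
have gU v x : q v = Some x -> r v = Some (g x).
  move=> vx; have [w [wU wx wy]] := gE x.
  have vU : v \in U by rewrite (minor_dom mX) vx.
  rewrite -wy; apply/eqP.
  by rewrite (minor_ker mY) // -(minor_ker mX) // wx vx.
have g'U v y : r v = Some y -> q v = Some (g' y).
  move=> vy; have [w [wU wy wx]] := g'E y.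
  have vU : v \in U by rewrite (minor_dom mY) vy.
  rewrite -wx; apply/eqP.
  by rewrite (minor_ker mX) // -(minor_ker mY) // wy vy.
have gK : cancel g g'.
  by move=> x; have [v [_ vx /g'U]] := gE x; rewrite vx => -[].
have g'K : cancel g' g.
  by move=> y; have [v [_ vy /gU]] := g'E y; rewrite vy => -[].
exists f, g; split.
- by exists f' => e; [apply: (minor_inj mX) | apply: (minor_inj mY)];
    rewrite ?f'E fE ?f'E.
- by exists g'.
move=> e; apply/setP => y; apply/idP/imsetP => [/(minor_inc mY)[v ve vy]|[x]].
  exists (g' y); rewrite ?g'K //.
  by apply/(minor_inc mX); exists v; [rewrite -fE | apply: g'U].
move=> /(minor_inc mX)[v ve vx] ->.
by apply/(minor_inc mY); exists v; [rewrite fE | apply: gU].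
Qed.

(** * Minors of minors *)

Section MinorOperations.
Variables (G : hypergraph) (F A : {set edges G}) (U : {set verts G}).

Definition inside (C : {set verts G}) : {set edges G} :=
  [set e in A | inc e \subset C].

Definition minor_verts : finType :=
  {B : {set verts G} | B \in [set vclass F v | v in U]}.

(** A canonical model that depends on the three sets only, so equal sets give equal minors. An edge
    contains a class as soon as it meets it, which is the direct image in the quotient. *)
Definition minor : hypergraph :=
  @Hypergraph {e | e \in A} minor_verts
    (fun e => [set x : minor_verts | ~~ [disjoint val x & inc (val e)]]).

Definition is_minor := saturated F U && [forall e in A, inc e \subset U].

Lemma minorP : is_minor ->
  minor_of F A U (X := minor) val
    (fun v => if v \in U then insub (vclass F v) else None).
Proof.
case/andP=> satU /forall_inP subU.
have qE v : v \in U ->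
    exists2 x : verts minor, insub (vclass F v) = Some x & val x = vclass F v.
  by move=> vU; case: insubP (imset_f (vclass F) vU) => [x _ ? _|/negP//]; exists x.
split=> //.
- exact: val_inj.
- apply/setP => e; apply/imsetP/idP => [[e' _ ->]|Ae]; first exact: valP.
  by exists (Sub e Ae).
- by move=> v; case: ifP => // vU; have [x ->] := qE v vU.
- move=> x; have /imsetP[v vU vx] := valP x; exists v.
  by rewrite vU -vx valK.
- move=> u v uU vU; rewrite uU vU; have [x -> xu] := qE u uU.
  by have [y -> yv] := qE v vU; rewrite -vclass_eq -xu -yv -val_eqE.
move=> e x; rewrite inE; split=> [/pred0Pn[v /andP[/= vx ve]]|[v ve]].
  have vU := subsetP (subU _ (valP e)) v ve; exists v; rewrite // vU.
  have /imsetP[u _ xu] := valP x.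
  move: vx; rewrite xu inE => uv.
  by rewrite -(valK x) xu; congr insub; apply/eqP; rewrite vclass_eq conn_sym.
case: ifP => // vU vx; apply/pred0Pn; exists v => /=; rewrite ve andbT.
have [y] := qE v vU; rewrite vx => -[->] ->; rewrite inE; exact: conn_refl.
Qed.

Variables (X : hypergraph) (i : edges X -> edges G).
Variable (q : verts G -> option (verts X)).
Hypothesis mX : minor_of F A U i q.

Lemma minor_of_is_minor : is_minor.
Proof.
by rewrite /is_minor (minor_sat mX); apply/forall_inP; apply: minor_sub mX.
Qed.

Lemma minor_of_hiso : hiso X minor.
Proof. exact: minor_uniq mX (minorP minor_of_is_minor). Qed.

Definition from_verts (U1 : {set verts X}) : {set verts G} :=
  [set v | oapp [in U1] false (q v)].

Lemma from_verts_saturated U1 : saturated F (from_verts U1).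
Proof.
apply/saturatedP => e u v Fe ue ve; rewrite !inE.
case qu : (q u) => [x|//] /= xU1.
have uU : u \in U by rewrite (minor_dom mX) qu.
have uv := conn_edge Fe ue ve.
have vU : v \in U by rewrite -(conn_saturated (minor_sat mX) uv).
by move: uv; rewrite -(minor_ker mX) // qu => /eqP<-.
Qed.

Lemma from_verts_sub U1 : from_verts U1 \subset U.
Proof.
by apply/subsetP => v; rewrite inE (minor_dom mX); case: (q v).
Qed.

Lemma from_vertsC U1 : from_verts (~: U1) = U :\: from_verts U1.
Proof.
by apply/setP => v; rewrite !inE (minor_dom mX); case: (q v) => //= x; rewrite inE andbT.
Qed.

Lemma img_edges (e : edges X) : i e \in A.
Proof. by rewrite -(minor_img mX) imset_f. Qed.

Lemma inc_from_verts (e : edges X) (U1 : {set verts X}) :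
  (inc e \subset U1) = (inc (i e) \subset from_verts U1).
Proof.
apply/subsetP/subsetP => [sub v ve|sub x /(minor_inc mX)[v ve vx]].
  have := subsetP (minor_sub mX (img_edges e)) v ve.
  rewrite (minor_dom mX) inE; case vx : (q v) => [x|//] _ /=.
  by apply: sub; apply/(minor_inc mX); exists v.
by have := sub v ve; rewrite inE vx.
Qed.

(** The contracted set is not cut down: no edge of [F] crosses the union of classes that remains, so
    the edges of [F] outside it have no influence on the classes inside. *)
Lemma minor_of_hrestr (U1 : {set verts X}) :
  minor_of F (inside (from_verts U1)) (from_verts U1) (X := hrestr U1)
    (i \o val) (fun v => obind insub (q v)).
Proof.
have qE v : v \in from_verts U1 ->
    exists2 x : verts (hrestr U1), obind insub (q v) = Some x & q v = Some (val x).
  rewrite inE; case vx : (q v) => [x|//] /= xU1.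
  by exists (Sub x xU1); rewrite // insubT.
split=> /=.
- exact: from_verts_saturated.
- by move=> e; rewrite inE => /andP[].
- exact: inj_comp (minor_inj mX) val_inj.
- apply/setP => e; rewrite inE; apply/imsetP/andP => [[e' _ ->] /=|[]].
    by rewrite img_edges -inc_from_verts (valP e').
  rewrite -(minor_img mX) => /imsetP[e' _ ->]; rewrite -inc_from_verts => e'U1.
  by exists (exist _ e' e'U1); rewrite ?inE.
- move=> v; apply/idP/idP => [/qE[x -> //]|]; rewrite inE.
  by case: (q v) => //= x; case: insubP.
- move=> x; have [v vx] := minor_surj mX (val x).
  by exists v; rewrite vx /= valK.
- move=> u v uU1 vU1; have [uU vU] := (subsetP (from_verts_sub _) _ uU1,
    subsetP (from_verts_sub _) _ vU1).
  have [x -> ux] := qE u uU1; have [y -> vy] := qE v vU1.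
  by rewrite -(minor_ker mX) // ux vy; apply/eqP/eqP=> [[->]|[/val_inj->]].
move=> e x; rewrite inE; split=> [/(minor_inc mX)[v ve vx]|[v ve vx]].
  by exists v; rewrite // vx /= valK.
apply/(minor_inc mX); exists v => //.
by case: (q v) vx => //= y; case: insubP => // z _ <- [->].
Qed.

Lemma minor_of_hsub (F1 : {set edges X}) :
  minor_of F (i @: F1) U (X := hsub F1) (i \o val) q.
Proof.
split=> /=.
- exact: minor_sat mX.
- move=> _ /imsetP[e _ ->]; apply: (minor_sub mX); exact: img_edges.
- exact: inj_comp (minor_inj mX) val_inj.
- apply/setP => e; apply/imsetP/imsetP => [[e' _ ->]|[e' Fe' ->]].
    by exists (val e') => //; apply: valP.
  by exists (exist _ e' Fe'); rewrite ?inE.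
- exact: minor_dom mX.
- exact: minor_surj mX.
- exact: minor_ker mX.
by move=> e x; apply: (minor_inc mX).
Qed.

(** Contracting in two stages amounts to contracting the union. The content is [connX], that
    connectedness in the quotient [X] under [F1] is connectedness in [G] under all contracted edges;
    saturated sets are moved along [q] in each direction. *)
Lemma minor_of_hcontract (F1 : {set edges X}) :
  minor_of (F :|: i @: F1) (A :\: i @: F1) U (X := hcontract F1) (i \o val)
    (fun v => omap (vproj F1) (q v)).
Proof.
have connX x y u v : q u = Some x -> q v = Some y ->
    conn F1 x y = conn (F :|: i @: F1) u v.
  move=> ux vy; have uU : u \in U by rewrite (minor_dom mX) ux.
  have vU : v \in U by rewrite (minor_dom mX) vy.
  apply/idP/idP => [/connP xy|uv].
    (* The image in [X] of the ambient class of [u]. Once it is saturated for [F1], it contains [y]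
       along with [x]. *)
    pose D := [set x | [exists v, (q v == Some x) && conn (F :|: i @: F1) u v]].
    have /xy : saturated F1 D.
      apply/saturatedP => e z t eF1 ze te; rewrite !inE.
      case/existsP=> w /andP[/eqP wz uw].
      case/(minor_inc mX): ze => w' w'e w'z.
      case/(minor_inc mX): te => s se st; apply/existsP; exists s.
      rewrite st eqxx /=; apply: conn_trans uw _; apply: (@conn_trans _ _ w').
        apply: connS (subsetUl _ _) _; rewrite -(minor_ker mX) ?wz ?w'z //.
          by rewrite (minor_dom mX) wz.
        by rewrite (minor_dom mX) w'z.
      by apply: conn_edge w'e se; rewrite inE imset_f ?orbT.
    rewrite !inE; case/(_ _)/existsP => [|w /andP[/eqP wy uw]].
      by apply/existsP; exists u; rewrite ux eqxx conn_refl.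
    apply: conn_trans uw _; apply: connS (subsetUl _ _) _.
    by rewrite -(minor_ker mX) ?wy ?vy // (minor_dom mX) wy.
  (* Conversely, the preimage of the class of [x] is saturated in [G], so it contains [v] along with
     [u]. *)
  have satD : saturated (F :|: i @: F1) (from_verts (vclass F1 x)).
    rewrite saturatedUl from_verts_saturated /=; apply/saturatedP => e s t.
    case/imsetP=> e' e'F1 -> se te; rewrite !inE.
    case sz : (q s) => [z|//] /=; rewrite inE => xz.
    have := subsetP (minor_sub mX (img_edges e')) t te.
    rewrite (minor_dom mX); case tz : (q t) => [z'|//] _ /=; rewrite inE.
    apply: conn_trans xz _; apply: conn_edge e'F1 _ _.
      by apply/(minor_inc mX); exists s.
    by apply/(minor_inc mX); exists t.
  have := conn_saturated satD uv; rewrite !inE ux vy /= !inE.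
  by rewrite /conn => <-; apply: conn_refl.
split=> /=.
- rewrite saturatedUl (minor_sat mX); apply/saturatedP => e u v.
  case/imsetP=> e' _ -> _ ve _.
  exact: subsetP (minor_sub mX (img_edges e')) v ve.
- by move=> e /setDP[/(minor_sub mX)].
- exact: inj_comp (minor_inj mX) val_inj.
- apply/setP => e; rewrite inE; apply/imsetP/andP => [[e' _ ->] /=|[]].
    rewrite img_edges (mem_imset _ _ (minor_inj mX)).
    by have := valP e'; rewrite inE => ->.
  rewrite -(minor_img mX) => /[swap] /imsetP[e' _ ->].
  rewrite (mem_imset _ _ (minor_inj mX)) => e'F1.
  have e'CF1 : e' \in ~: F1 by rewrite inE.
  by exists (exist _ e' e'CF1); rewrite ?inE.
- by move=> v; rewrite (minor_dom mX); case: (q v).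
- move=> x; have [y <-] := vproj_surj x.
  by have [v vy] := minor_surj mX y; exists v; rewrite vy.
- move=> u v; rewrite !(minor_dom mX).
  case ux : (q u) => [x|//] _; case vy : (q v) => [y|//] _ /=.
  rewrite -(connX _ _ _ _ ux vy) -vproj_eq.
  by apply/eqP/eqP => [/Some_inj->|->].
move=> e x; split=> [/imsetP[y /(minor_inc mX)[v ve vy] ->]|[v ve]].
  by exists v; rewrite ?vy.
case vy: (q v) => [y|//] /= [<-]; apply: imset_f; apply/(minor_inc mX).
by exists v.
Qed.

End MinorOperations.

(** * Disjoint unions and common ambient hypergraphs *)

Lemma mem_inl (T1 T2 : finType) (A : {set T1}) x :
  ((inl x : T1 + T2) \in [set inl y | y in A]) = (x \in A).
Proof. by rewrite mem_imset // => ? ? []. Qed.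

Lemma mem_inr (T1 T2 : finType) (A : {set T2}) x :
  ((inr x : T1 + T2) \in [set inr y | y in A]) = (x \in A).
Proof. by rewrite mem_imset // => ? ? []. Qed.

Lemma inl_notin_inr (T1 T2 : finType) (A : {set T2}) x :
  ((inl x : T1 + T2) \in [set inr y | y in A]) = false.
Proof. by apply/imsetP => -[]. Qed.

Lemma inr_notin_inl (T1 T2 : finType) (A : {set T1}) x :
  ((inr x : T1 + T2) \in [set inl y | y in A]) = false.
Proof. by apply/imsetP => -[]. Qed.

Definition mem_sumE := (mem_inl, mem_inr, inl_notin_inr, inr_notin_inl).

(** As [U1] is saturated and disjoint from [U2], no class of [F] meets both, so the classes of the
    union are those of the two parts. Trying [q] before [r] involves no choice, since their domains
    are disjoint. *)
Lemma minor_of_hunion G (F A1 A2 : {set edges G}) (U1 U2 : {set verts G}) X Y i j q r :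
  [disjoint A1 & A2] -> [disjoint U1 & U2] ->
  @minor_of G F A1 U1 X i q -> @minor_of G F A2 U2 Y j r ->
  minor_of F (A1 :|: A2) (U1 :|: U2) (X := hunion X Y)
    (fun e => match e with inl e => i e | inr e => j e end)
    (fun v => if q v is Some x then Some (inl x) else omap inr (r v)).
Proof.
move=> dA dU mX mY.
have rN v x : q v = Some x -> r v = None.
  move=> vx; have vU : v \in U1 by rewrite (minor_dom mX) vx.
  by move: (disjointFr dU vU); rewrite (minor_dom mY); case: (r v).
have connN u v : u \in U1 -> v \in U2 -> conn F u v = false.
  move=> uU vU; apply/negP => uv; move: (disjointFl dU vU).
  by rewrite -(conn_saturated (minor_sat mX) uv) uU.
split.
- exact: saturatedU (minor_sat mX) (minor_sat mY).
- move=> e; rewrite inE => /orP[/(minor_sub mX)|/(minor_sub mY)] sub.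
    exact: subset_trans sub (subsetUl _ _).
  exact: subset_trans sub (subsetUr _ _).
- have ijN e e' : i e <> j e'.
    move=> ij; have := disjointFr dA (img_edges mX e).
    by rewrite ij (img_edges mY).
  move=> [e|e] [e'|e'] => [/(minor_inj mX)->||/esym|/(minor_inj mY)->] //;
    by move/ijN.
- rewrite -(minor_img mX) -(minor_img mY); apply/setP => e; rewrite inE.
  apply/imsetP/orP => [[[] e' _ ->]|[/imsetP[e' _ ->]|/imsetP[e' _ ->]]].
  + by left; rewrite imset_f.
  + by right; rewrite imset_f.
  + by exists (inl e').
  + by exists (inr e').
- move=> v; rewrite inE (minor_dom mX) (minor_dom mY).
  by case: (q v); case: (r v).
- move=> [x|y]; first by have [v vx] := minor_surj mX x; exists v; rewrite vx.
  have [v vy] := minor_surj mY y; exists v; case vx: (q v) => [x|].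
    by rewrite (rN _ _ vx) in vy.
  by rewrite vy.
- move=> u v; rewrite !inE ![_ \in U1](minor_dom mX) ![_ \in U2](minor_dom mY).
  case ux : (q u) => [x|] /=; case vx : (q v) => [x'|] /=.
  + by rewrite -(minor_ker mX) ?ux ?vx ?(minor_dom mX) ?ux ?vx.
  + case vy: (r v) => [y|//] _ _ /=; rewrite connN ?(minor_dom mX) ?ux //.
    by rewrite (minor_dom mY) vy.
  + case vy: (r u) => [y|//] _ _ /=.
    rewrite conn_sym connN ?(minor_dom mX) ?vx //.
    by rewrite (minor_dom mY) vy.
  case uy: (r u) => [y|//] _; case vy: (r v) => [y'|//] _ /=.
  by rewrite -(minor_ker mY) ?uy ?vy ?(minor_dom mY) ?uy ?vy.
move=> [e|e] [x|y] /=.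
- rewrite mem_inl; split=> [/(minor_inc mX)[v ve vx]|[v ve vx]].
    by exists v; rewrite ?vx.
  apply/(minor_inc mX); exists v => //.
  by case: (q v) vx => [x' [->]|]; case: (r v).
- split=> [/imsetP[]//|[v ve]].
  have := subsetP (minor_sub mX (img_edges mX e)) v ve.
  by rewrite (minor_dom mX); case: (q v).
- split=> [/imsetP[]//|[v ve]].
  have := subsetP (minor_sub mY (img_edges mY e)) v ve.
  rewrite (minor_dom mY); case vx: (q v) => [x'|]; first by rewrite (rN _ _ vx).
  by case: (r v).
rewrite mem_inr; split=> [/(minor_inc mY)[v ve vy]|[v ve vy]].
  exists v; rewrite ?vy //; case vx: (q v) => [x'|//].
  by rewrite (rN _ _ vx) in vy.
apply/(minor_inc mY); exists v => //.
by case: (q v) vy => //; case: (r v) => //= y' [->].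
Qed.

(** Stated up to isomorphism so that the representative chosen for a class can be handled inside the
    hypergraph that it represents. *)
Lemma minor_of_id G X : hiso G X -> exists i q, @minor_of G set0 setT setT X i q.
Proof.
move=> /hiso_sym[f [g [bf [g' gK g'K] fg]]].
exists f, (Some \o g'); split=> //=.
- exact: saturatedT.
- exact: bij_inj.
- case: bf => f' fK f'K; apply/setP => e; rewrite inE.
  by apply/imsetP; exists (f' e).
- by move=> v; rewrite inE.
- by move=> x; exists (g x); rewrite gK.
- move=> u v _ _; rewrite conn0; apply/eqP/eqP => [[/(can_inj g'K)]|->//].
  by [].
move=> e x; rewrite fg; split=> [xe|[v ve [vx]]].
  by exists (g x); rewrite ?gK ?imset_f.
by move: ve; rewrite -(g'K v) vx mem_imset //; apply: can_inj gK.
Qed.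

(** With its mirror image below, this puts two unrelated hypergraphs into one ambient hypergraph, on
    disjoint vertex sets. *)
Lemma minor_of_inl G1 G2 :
  @minor_of (hunion G1 G2) set0 (inl @: setT) (inl @: setT) G1 inl
    (fun v => if v is inl x then Some x else None).
Proof.
split.
- exact: saturated0.
- by move=> _ /imsetP[e _ ->]; apply: imsetS; apply: subsetT.
- by move=> ? ? [].
- by [].
- move=> [v|v] /=; first by rewrite imset_f.
  by apply/imsetP => -[].
- by move=> x; exists (inl x).
- move=> _ _ /imsetP[u _ ->] /imsetP[v _ ->]; rewrite conn0.
  by [].
move=> e x; split=> [xe|[_ /imsetP[v ve ->] [<-]] //].
by exists (inl x); rewrite ?imset_f.
Qed.

Lemma minor_of_inr G1 G2 :
  @minor_of (hunion G1 G2) set0 (inr @: setT) (inr @: setT) G2 inr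
    (fun v => if v is inr x then Some x else None).
Proof.
split.
- exact: saturated0.
- by move=> _ /imsetP[e _ ->]; apply: imsetS; apply: subsetT.
- by move=> ? ? [].
- by [].
- move=> [v|v] /=; last by rewrite imset_f.
  by apply/imsetP => -[].
- by move=> x; exists (inr x).
- move=> _ _ /imsetP[u _ ->] /imsetP[v _ ->]; rewrite conn0.
  by [].
move=> e x; split=> [xe|[_ /imsetP[v ve ->] [<-]] //].
by exists (inr x); rewrite ?imset_f.
Qed.

(** A class contained in [U] meets no edge of [F'], so it stays saturated after adding [F'] and does
    not grow. This is how two minors with different contracted sets are given a common one. *)
Lemma minor_of_setUl G (F F' A : {set edges G}) U X i q :
  (forall e, e \in F' -> inc e \subset ~: U) ->
  @minor_of G F A U X i q -> minor_of (F :|: F') A U i q.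
Proof.
move=> F'U mX; have satC C : saturated F C -> C \subset U -> saturated (F :|: F') C.
  move=> sat sub; rewrite saturatedUl sat; apply/saturatedP => e u v eF' ue _ uC.
  by have := subsetP (F'U e eF') u ue; rewrite inE (subsetP sub).
split=> //.
- exact: satC (minor_sat mX) (subxx _).
- exact: minor_sub mX.
- exact: minor_inj mX.
- exact: minor_img mX.
- exact: minor_dom mX.
- exact: minor_surj mX.
- move=> u v uU vU; rewrite (minor_ker mX) //; apply/idP/connP => [uv C sC|uv].
    by rewrite -(conn_saturated (saturatedS (subsetUl _ _) sC) uv).
  have := uv (vclass F u); rewrite !inE; apply; last exact: conn_refl.
  apply: satC; first exact: saturated_vclass.
  apply/subsetP => w; rewrite inE => uw.
  by rewrite -(conn_saturated (minor_sat mX) uw).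
exact: minor_inc mX.
Qed.

Definition no_empty_edge G := forall e : edges G, inc e != set0.

Lemma no_empty_edge_minor G F A U X i q :
  @minor_of G F A U X i q -> no_empty_edge G -> no_empty_edge X.
Proof.
move=> mX gG e; have /set0Pn[v ve] := gG (i e).
have := subsetP (minor_sub mX (img_edges mX e)) v ve.
rewrite (minor_dom mX); case vx: (q v) => [x|//] _; apply/set0Pn; exists x.
by apply/(minor_inc mX); exists v.
Qed.

Lemma no_empty_edge_hiso G X : hiso G X -> no_empty_edge G -> no_empty_edge X.
Proof. by move=> /minor_of_id[i [q]]; apply: no_empty_edge_minor. Qed.

Lemma no_empty_edge_hunion G G' :
  no_empty_edge G -> no_empty_edge G' -> no_empty_edge (hunion G G').
Proof.
move=> gG gG' [e|e]; rewrite -card_gt0 card_imset ?card_gt0 //.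
- by move=> ? ? [].
- by move=> ? ? [].
Qed.

Lemma no_empty_edge_hrestr G (U : {set verts G}) :
  no_empty_edge G -> no_empty_edge (hrestr U).
Proof.
have [i [q mG]] := minor_of_id (hiso_refl G).
exact: no_empty_edge_minor (minor_of_hrestr mG U).
Qed.

Lemma no_empty_edge_hsub G (F : {set edges G}) :
  no_empty_edge G -> no_empty_edge (hsub F).
Proof. by move=> gG e; apply: gG. Qed.

Lemma no_empty_edge_hcontract G (F : {set edges G}) :
  no_empty_edge G -> no_empty_edge (hcontract F).
Proof.
have [i [q mG]] := minor_of_id (hiso_refl G).
exact: no_empty_edge_minor (minor_of_hcontract mG F).
Qed.

Lemma card_edges_minor G F A U X i q :
  @minor_of G F A U X i q -> (#|edges X| == 0)%N = (A == set0).
Proof.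
move=> mX; rewrite -(minor_img mX) -cards_eq0.
by rewrite card_imset ?cardsT //; apply: minor_inj mX.
Qed.

Lemma card_verts_minor G F A U X i q :
  @minor_of G F A U X i q -> (#|verts X| == 0)%N = (U == set0).
Proof.
move=> mX; apply/eqP/eqP => [cX|U0].
  have X0 := card0_eq cX; apply/setP => v.
  by rewrite (minor_dom mX) inE; case: (q v) => [x|//]; have := X0 x; rewrite inE.
apply/eqP/pred0P => x; have [v vx] := minor_surj mX x.
by have := minor_dom mX v; rewrite vx U0 inE.
Qed.

(** * Sums over subsets and tensors *)

Section SubsetSums.
Variables (T : finType) (W : nmodType).

Lemma setDUK (C D : {set T}) : D \subset C -> D :|: (C :\: D) = C.
Proof. by move=> sDC; rewrite -{2}(setID C D) (setIidPr sDC). Qed.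

Lemma setTD_eq0 (C : {set T}) :
  (setT :\: C == set0) = (C == setT).
Proof. by rewrite setD_eq0 subTset. Qed.

Lemma setDUU (A1 A2 C1 C2 : {set T}) : [disjoint A1 & A2] ->
  C1 \subset A1 -> C2 \subset A2 ->
  (A1 :|: A2) :\: (C1 :|: C2) = (A1 :\: C1) :|: (A2 :\: C2).
Proof.
move=> dA /subsetP sC1 /subsetP sC2; apply/setP => x; rewrite !inE.
have := disjointFr dA (x := x); have := sC1 x; have := sC2 x.
case: (x \in A1); case: (x \in A2); case: (x \in C1); case: (x \in C2) => //=;
  do ?[by move=> _ _ /(_ isT)]; do ?[by move=> _ /(_ isT)]; by move/(_ isT).
Qed.

Lemma big_subsetU (A1 A2 : {set T}) (f : {set T} -> W) : [disjoint A1 & A2] ->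
  \sum_(C : {set T} | C \subset A1 :|: A2) f C =
  \sum_(C1 : {set T} | C1 \subset A1) \sum_(C2 : {set T} | C2 \subset A2) f (C1 :|: C2).
Proof.
move=> dA; rewrite pair_big /=.
rewrite (reindex_onto (fun p : {set T} * {set T} => p.1 :|: p.2)
  (fun C => (C :&: A1, C :&: A2))) /= => [|C]; last first.
  by rewrite -setIUr => /setIidPl.
apply: eq_bigl => -[C1 C2] /=; apply/andP/andP => [[sC]|[sC1 sC2]].
  by move=> /eqP[<- <-]; rewrite !subsetIr.
rewrite setUSS //; split=> //; rewrite !setIUl.
have /eqP-> : C2 :&: A1 == set0.
  by rewrite setI_eq0 (disjointWl sC2) // disjoint_sym.
have /eqP-> : C1 :&: A2 == set0 by rewrite setI_eq0 (disjointWl sC1).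
by rewrite setU0 set0U; apply/eqP; congr (_, _); apply/setIidPl.
Qed.

(* Both sides run over the ordered partitions of [A] into three blocks. *)
Lemma big_subset_flag (A : {set T}) (f : {set T} -> {set T} -> {set T} -> W) :
  \sum_(C : {set T} | C \subset A) \sum_(D : {set T} | D \subset C)
    f D (C :\: D) (A :\: C) =
  \sum_(D : {set T} | D \subset A) \sum_(E : {set T} | E \subset A :\: D)
    f D E ((A :\: D) :\: E).
Proof.
rewrite (exchange_big_dep (fun D : {set T} => D \subset A)) /=; last first.
  by move=> C D sCA sDC; apply: subset_trans sCA.
apply: eq_bigr => D sDA.
rewrite (reindex_onto (fun E => D :|: E) (fun C => C :\: D)) /=; last first.
  by move=> C /andP[_ sDC]; rewrite -{2}(setID C D) (setIidPr sDC).
apply: eq_big => [E|E /andP[_ /eqP->]]; last by rewrite setDDl.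
rewrite subUset sDA subsetUl andbT /= setDUl setDv set0U subsetD.
by congr (_ && _); apply/eqP/setDidPl.
Qed.

End SubsetSums.

Lemma sum_indicator (K : fieldType) (V : lmodType K) (I : finType) (P : pred I)
    (i0 : I) (f : I -> V) : P i0 ->
  \sum_(i | P i) (i == i0)%:R *: f i = f i0.
Proof.
move=> Pi0; rewrite (bigD1 i0) //= eqxx scale1r big1 ?addr0 // => i.
by case/andP=> _ /negPf->; rewrite scale0r.
Qed.

Section TensorSums.
Variables (K : fieldType) (U V : lmodType K).

Lemma tens_suml (I : finType) (P : pred I) (f : I -> U) (v : V) :
  (\sum_(i | P i) f i) \ox v = \sum_(i | P i) f i \ox v.
Proof.
apply: (big_morph (fun u => u \ox v)) => [x y|]; last exact: linear0l.
by have := tensPl 1 x y v; rewrite !scale1r.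
Qed.

Lemma tens_sumr (I : finType) (P : pred I) (u : U) (f : I -> V) :
  u \ox (\sum_(i | P i) f i) = \sum_(i | P i) u \ox f i.
Proof.
apply: (big_morph (fun v => u \ox v)) => [x y|]; last exact: linear0r.
by have := tensPr u 1 x y; rewrite !scale1r.
Qed.

End TensorSums.

Section LinearSums.
Variables (K : fieldType) (A B C D A' B' : lmodType K).
Variables (I : finType) (P : pred I).

Lemma tmap_sum (f : {linear A -> A'}) (g : {linear B -> B'}) (t : I -> A ⊗ B) :
  tmap f g (\sum_(i | P i) t i) = \sum_(i | P i) tmap f g (t i).
Proof. exact: linear_sum. Qed.

Lemma tassoc_sum (t : I -> (A ⊗ B) ⊗ C) :
  tassoc (\sum_(i | P i) t i) = \sum_(i | P i) tassoc (t i).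
Proof. exact: linear_sum. Qed.

Lemma tinter_sum (t : I -> (A ⊗ B) ⊗ (C ⊗ D)) :
  tinter (\sum_(i | P i) t i) = \sum_(i | P i) tinter (t i).
Proof. exact: linear_sum. Qed.

Lemma tunitl_sum (t : I -> K^o ⊗ A) :
  tunitl (\sum_(i | P i) t i) = \sum_(i | P i) tunitl (t i).
Proof. exact: linear_sum. Qed.

Lemma tunitr_sum (t : I -> A ⊗ K^o) :
  tunitr (\sum_(i | P i) t i) = \sum_(i | P i) tunitr (t i).
Proof. exact: linear_sum. Qed.

End LinearSums.

Definition tensor_sumE :=
  (tmap_sum, tassoc_sum, tinter_sum, tunitl_sum, tunitr_sum).

Section MinorSums.
Variables (G : hypergraph) (F A : {set edges G}) (U : {set verts G}).
Variables (X : hypergraph) (i : edges X -> edges G).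
Variable (q : verts G -> option (verts X)).
Hypothesis mX : minor_of F A U i q.
Variable W : nmodType.

Lemma sum_img_edges (f : {set edges G} -> W) :
  \sum_(F1 : {set edges X}) f (i @: F1) = \sum_(D : {set edges G} | D \subset A) f D.
Proof.
rewrite [RHS](reindex_onto (fun F1 : {set edges X} => i @: F1)
  (fun D => i @^-1: D)) /= => [|D sDA]; last first.
  apply/setP => e; apply/imsetP/idP => [[e'] |eD]; first by rewrite inE => ? ->.
  have := subsetP sDA e eD; rewrite -(minor_img mX) => /imsetP[e' _ ee'].
  by exists e'; rewrite // inE -ee'.
apply: eq_bigl => F1; apply/esym/andP; split.
  by apply/subsetP => _ /imsetP[e _ ->]; apply: img_edges mX e.
by apply/eqP/setP => e; rewrite inE mem_imset //; apply: minor_inj mX.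
Qed.

(** Sets of vertices of a quotient correspond to unions of classes: the inverse sends a saturated
    [C] to the classes that it meets. The saturation condition is what couples the vertex sum of
    [Delta] to the contracted edges. *)
Lemma sum_from_verts (f : {set verts G} -> W) :
  \sum_(U1 : {set verts X}) f (from_verts q U1) =
  \sum_(C : {set verts G} | (C \subset U) && saturated F C) f C.
Proof.
rewrite [RHS](reindex_onto (fun U1 : {set verts X} => from_verts q U1)
  (fun C => [set x | [exists v in C, q v == Some x]])) /=; last first.
  move=> C /andP[sCU satC]; apply/setP => v; rewrite inE.
  apply/idP/idP => [|vC].
    case vx: (q v) => [x|//] /=; rewrite inE => /exists_inP[u uC /eqP ux].
    rewrite -(conn_saturated satC (u := u)) // -(minor_ker mX) ?ux ?vx //.
      exact: subsetP uC.
    by rewrite (minor_dom mX) vx.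
  have := subsetP sCU v vC; rewrite (minor_dom mX); case vx: (q v) => [x|//] _ /=.
  by rewrite inE; apply/exists_inP; exists v; rewrite ?vx.
apply: eq_bigl => U1; apply/esym/andP; split.
  by rewrite (from_verts_sub mX) (from_verts_saturated mX).
apply/eqP/setP => x; rewrite inE; apply/exists_inP/idP => [[v]|xU1].
  by rewrite inE => /[swap] /eqP->.
by have [v vx] := minor_surj mX x; exists v; rewrite ?inE vx.
Qed.

End MinorSums.

Lemma hiso_empty G G' : #|edges G| = 0%N -> #|verts G| = 0%N ->
  #|edges G'| = 0%N -> #|verts G'| = 0%N -> hiso G G'.
Proof.
move=> E0 V0 E0' V0'.
have empty (T : finType) (x : T) : #|T| = 0%N -> False.
  by move=> /card0_eq/(_ x); rewrite inE.
exists (fun e => False_rect _ (empty _ e E0)).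
exists (fun v => False_rect _ (empty _ v V0)).
split=> [||e]; last by case: (empty _ e E0).
  by exists (fun e => False_rect _ (empty _ e E0')) => e;
    [case: (empty _ e E0) | case: (empty _ e E0')].
by exists (fun v => False_rect _ (empty _ v V0')) => v;
  [case: (empty _ v V0) | case: (empty _ v V0')].
Qed.

(** * The double bialgebra axioms *)

Section IsMinor.
Variable G : hypergraph.
Implicit Types (F A D : {set edges G}) (U C : {set verts G}).

Lemma is_minorP F A U :
  reflect (saturated F U /\ forall e, e \in A -> inc e \subset U)
          (is_minor F A U).
Proof. by apply: (iffP andP) => -[-> /forall_inP]. Qed.

Lemma is_minorT : is_minor set0 [set: edges G] setT.
Proof. by apply/is_minorP; split=> [|e _]; rewrite ?saturated0 ?subsetT. Qed.

Lemma is_minor_inside F A C : saturated F C -> is_minor F (inside A C) C.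
Proof. by move=> satC; apply/is_minorP; split=> // e; rewrite inE => /andP[]. Qed.

Lemma is_minor_sub F A D U : D \subset A -> is_minor F A U -> is_minor F D U.
Proof.
move=> /subsetP DA /is_minorP[satU AU]; apply/is_minorP.
by split=> // e /DA; apply: AU.
Qed.

Lemma is_minor_contract F A D U :
  D \subset A -> is_minor F A U -> is_minor (F :|: D) (A :\: D) U.
Proof.
move=> /subsetP DA /is_minorP[satU AU]; apply/is_minorP; split.
  rewrite saturatedUl satU; apply/saturatedP => e u v /DA/AU/subsetP eU _ ve _.
  exact: eU.
by move=> e /setDP[/AU].
Qed.

Lemma is_minorU F A1 A2 U1 U2 :
  is_minor F A1 U1 -> is_minor F A2 U2 -> is_minor F (A1 :|: A2) (U1 :|: U2).
Proof.
move=> /is_minorP[sat1 AU1] /is_minorP[sat2 AU2]; apply/is_minorP.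
split=> [|e]; first exact: saturatedU.
by rewrite inE => /orP[/AU1|/AU2] sub; apply: subset_trans sub _;
  rewrite ?subsetUl ?subsetUr.
Qed.

Lemma insideT A : inside A setT = A.
Proof. by apply/setP => e; rewrite inE subsetT andbT. Qed.

Lemma inside_inside A C C' : C' \subset C -> inside (inside A C) C' = inside A C'.
Proof.
move=> sC'C; apply/setP => e; rewrite !inE -andbA; congr (_ && _).
by apply/andb_idl => eC'; apply: subset_trans eC' sC'C.
Qed.

Lemma inside_union A1 A2 U1 U2 C1 C2 : [disjoint U1 & U2] ->
  (forall e, e \in A1 -> inc e \subset U1) ->
  (forall e, e \in A2 -> inc e \subset U2) ->
  C1 \subset U1 -> C2 \subset U2 ->
  inside (A1 :|: A2) (C1 :|: C2) = inside A1 C1 :|: inside A2 C2.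
Proof.
move=> dU AU1 AU2 sC1 sC2; apply/setP => e; rewrite !inE andb_orl.
congr (_ || _); apply: andb_id2l => Ae; apply/subsetP/subsetP => sub v ve.
- have vU := subsetP (AU1 e Ae) v ve; have := sub v ve.
  by rewrite inE => /orP[//|/(subsetP sC2)]; rewrite (disjointFr dU vU).
- by rewrite inE sub.
- have vU := subsetP (AU2 e Ae) v ve; have := sub v ve.
  by rewrite inE => /orP[/(subsetP sC1)|//]; rewrite (disjointFl dU vU).
- by rewrite inE sub ?orbT.
Qed.

Lemma no_empty_edge_disjoint A1 A2 U1 U2 : no_empty_edge G ->
  [disjoint U1 & U2] ->
  (forall e, e \in A1 -> inc e \subset U1) ->
  (forall e, e \in A2 -> inc e \subset U2) -> [disjoint A1 & A2].
Proof.
move=> gG dU AU1 AU2; apply/pred0P => e /=; apply/negP => /andP[/AU1 e1 /AU2 e2].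
have /set0Pn[v ve] := gG e.
by have := disjointFr dU (subsetP e1 v ve); rewrite (subsetP e2).
Qed.

(** The combinatorial core of the cointeraction. For fixed [C], an edge set that does not cross [C]
    is a choice of edges within [C] together with a choice within its complement, so the sum over
    [D] factors by [big_subsetU]. *)
Lemma saturated_inside D C : no_empty_edge G ->
  saturated D C = (D \subset inside setT C :|: inside setT (setT :\: C)).
Proof.
move=> gG; apply/forall_inP/subsetP => sub e /sub; rewrite !inE //.
  by rewrite setTD.
by rewrite setTD.
Qed.

End IsMinor.
Arguments is_minorP {G F A U}.

Lemma hiso_hunionA G G' G'' :
  hiso (hunion (hunion G G') G'') (hunion G (hunion G' G'')).
Proof.
have assocP (T1 T2 T3 : Type) : bijective (fun x : (T1 + T2) + T3 =>
    match x with inl (inl y) => inl y | inl (inr y) => inr (inl y)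
               | inr y => inr (inr y) end : T1 + (T2 + T3)).
  by exists (fun x => match x with inl y => inl (inl y)
    | inr (inl y) => inl (inr y) | inr (inr y) => inr y end) => [[[]|]|[|[]]].
do 2 eexists; split; [exact: assocP | exact: assocP |].
by move=> [[e|e]|e] /=; rewrite -!imset_comp.
Qed.

Lemma disjoint_inl_inr (T1 T2 : finType) :
  [disjoint [set (inl x : T1 + T2) | x in setT] & [set (inr x : T1 + T2) | x in setT]].
Proof.
by apply/pred0P => v /=; apply/negP => /andP[/imsetP[? _ ->] /imsetP[]].
Qed.

(** * The axioms for a spanning family satisfying the formulas without empty edges *)

Section Formulas.
Variables (K : fieldType) (B : lmodType K) (b : hypergraph -> B).
Hypothesis b_hiso : forall X Y, hiso X Y -> b X = b Y.

Local Notation m F A U := (b (minor F A U)).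

Lemma minor_of_b G F A U X i q : @minor_of G F A U X i q -> b X = m F A U.
Proof. by move=> mX; apply: b_hiso (minor_of_hiso mX). Qed.

Lemma b_minorT G : b G = m set0 [set: edges G] setT.
Proof.
have [i [q mG]] := minor_of_id (hiso_refl G); exact: minor_of_b mG.
Qed.

Lemma sum_hrestr G F A U X i q : @minor_of G F A U X i q ->
  \sum_(U1 : {set verts X}) b (hrestr U1) \ox b (hrestr (~: U1)) =
  \sum_(C : {set verts G} | (C \subset U) && saturated F C)
    m F (inside A C) C \ox m F (inside A (U :\: C)) (U :\: C).
Proof.
move=> mX; rewrite -(sum_from_verts mX (fun C => m F (inside A C) C \ox
  m F (inside A (U :\: C)) (U :\: C))); apply: eq_bigr => U1 _.
rewrite (minor_of_b (minor_of_hrestr mX U1)).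
by rewrite (minor_of_b (minor_of_hrestr mX (~: U1))) (from_vertsC mX).
Qed.

Lemma sum_hcontract G F A U X i q : @minor_of G F A U X i q ->
  \sum_(F1 : {set edges X}) b (hsub F1) \ox b (hcontract F1) =
  \sum_(D : {set edges G} | D \subset A)
    m F D U \ox m (F :|: D) (A :\: D) U.
Proof.
move=> mX; rewrite -(sum_img_edges mX (fun D => m F D U \ox
  m (F :|: D) (A :\: D) U)); apply: eq_bigr => F1 _.
rewrite (minor_of_b (minor_of_hsub mX F1)).
by rewrite (minor_of_b (minor_of_hcontract mX F1)).
Qed.

Lemma m_setUl G (F F' A : {set edges G}) U :
  is_minor F A U -> (forall e, e \in F' -> inc e \subset ~: U) ->
  m (F :|: F') A U = m F A U.
Proof. by move=> /minorP mX F'U; rewrite -(minor_of_b (minor_of_setUl F'U mX)). Qed.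

Variables (mu : {linear B ⊗ B -> B}) (eta : {linear K^o -> B}).
Variables (Delta delta : {linear B -> B ⊗ B}) (epsD epsd : {linear B -> K^o}).
(** The family spans [B], phrased as induction so that linear and bilinear identities reduce
    directly to generators. *)
Hypothesis b_ind : forall P : B -> Prop, P 0 ->
  (forall a x y, P x -> P y -> P (a *: x + y)) ->
  (forall G, no_empty_edge G -> P (b G)) -> forall x, P x.
Hypothesis muE : forall G G', no_empty_edge G -> no_empty_edge G' ->
  mu (b G \ox b G') = b (hunion G G').
Hypothesis etaE : eta 1 = b hempty.
Hypothesis DeltaE : forall G, no_empty_edge G -> Delta (b G) =
  \sum_(U : {set verts G}) b (hrestr U) \ox b (hrestr (~: U)).
(** The sum runs over all edge sets: without empty edges, the restriction to sets of non-empty edges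
    is vacuous. *)
Hypothesis deltaE : forall G, no_empty_edge G -> delta (b G) =
  \sum_(F : {set edges G}) b (hsub F) \ox b (hcontract F).
Hypothesis epsDE : forall G, no_empty_edge G ->
  epsD (b G) = (#|verts G| == 0)%N%:R.
Hypothesis epsdE : forall G, no_empty_edge G ->
  epsd (b G) = (#|edges G| == 0)%N%:R.

Section Ambient.
Variable G : hypergraph.
Hypothesis gG : no_empty_edge G.
Implicit Types (F A D : {set edges G}) (U C : {set verts G}).

Lemma no_empty_edge_m F A U : is_minor F A U -> no_empty_edge (minor F A U).
Proof. by move=> /minorP mX; apply: no_empty_edge_minor mX gG. Qed.

Lemma Delta_m F A U : is_minor F A U -> Delta (m F A U) =
  \sum_(C : {set verts G} | (C \subset U) && saturated F C)
    m F (inside A C) C \ox m F (inside A (U :\: C)) (U :\: C).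
Proof.
by move=> mF; rewrite DeltaE; [apply: sum_hrestr (minorP mF) | apply: no_empty_edge_m].
Qed.

Lemma Delta_m0 A U : is_minor set0 A U -> Delta (m set0 A U) =
  \sum_(C : {set verts G} | C \subset U)
    m set0 (inside A C) C \ox m set0 (inside A (U :\: C)) (U :\: C).
Proof.
by move=> /Delta_m->; apply: eq_bigl => C; rewrite saturated0 andbT.
Qed.

Lemma delta_m F A U : is_minor F A U -> delta (m F A U) =
  \sum_(D : {set edges G} | D \subset A) m F D U \ox m (F :|: D) (A :\: D) U.
Proof.
by move=> mF; rewrite deltaE; [apply: sum_hcontract (minorP mF) | apply: no_empty_edge_m].
Qed.

Lemma mu_m F A1 A2 U1 U2 : [disjoint U1 & U2] ->
  is_minor F A1 U1 -> is_minor F A2 U2 ->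
  mu (m F A1 U1 \ox m F A2 U2) = m F (A1 :|: A2) (U1 :|: U2).
Proof.
move=> dU m1 m2; rewrite muE; [|exact: no_empty_edge_m..].
have dA : [disjoint A1 & A2].
  case/is_minorP: m1 => _ AU1; case/is_minorP: m2 => _ AU2.
  exact: no_empty_edge_disjoint dU AU1 AU2.
by rewrite (minor_of_b (minor_of_hunion dA dU (minorP m1) (minorP m2))).
Qed.

Lemma epsD_m F A U : is_minor F A U -> epsD (m F A U) = (U == set0)%:R.
Proof.
move=> mF; rewrite epsDE; last exact: no_empty_edge_m.
by rewrite (card_verts_minor (minorP mF)).
Qed.

Lemma epsd_m F A U : is_minor F A U -> epsd (m F A U) = (A == set0)%:R.
Proof.
move=> mF; rewrite epsdE; last exact: no_empty_edge_m.
by rewrite (card_edges_minor (minorP mF)).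
Qed.

(** Places the unit inside any ambient hypergraph, so that multiplying by it becomes a union with
    empty sets. *)
Lemma m_empty F : b hempty = m F set0 set0.
Proof.
have sat0 : is_minor F set0 set0.
  apply/is_minorP; split=> [|e]; last by rewrite inE.
  by apply/saturatedP => e u v; rewrite !inE.
have mX := minorP sat0; apply: b_hiso; apply: hiso_empty; rewrite ?card_void //.
  by apply/eqP; rewrite (card_edges_minor mX).
by apply/eqP; rewrite (card_verts_minor mX).
Qed.

End Ambient.

Lemma b_ext (W : lmodType K) (f g : {linear B -> W}) :
  (forall G, no_empty_edge G -> f (b G) = g (b G)) -> f =1 g.
Proof.
move=> fg; elim/b_ind => [|a x y fx fy|//]; first by rewrite !linear0.
by rewrite !linearP fx fy.
Qed.

Lemma b_ext2 (W : lmodType K) (f g : {linear B ⊗ B -> W}) :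
  (forall G G', no_empty_edge G -> no_empty_edge G' ->
     f (b G \ox b G') = g (b G \ox b G')) ->
  forall x y, f (x \ox y) = g (x \ox y).
Proof.
move=> fg x y; elim/b_ind: x => [|a x x' fx fx'|G gG].
- by rewrite linear0l !linear0.
- by rewrite tensPl !linearP fx fx'.
elim/b_ind: y => [|a y y' fy fy'|G' gG'].
- by rewrite linear0r !linear0.
- by rewrite tensPr !linearP fy fy'.
exact: fg.
Qed.

Lemma b_unital_algebra : unital_algebra mu eta.
Proof.
split=> [x y z|x]; last first.
  rewrite etaE; elim/b_ind: x => [|a x y [IHx IHx'] [IHy IHy']|G gG].
  - by rewrite linear0l linear0r linear0.
  - by rewrite tensPl tensPr !linearP /= IHx IHx' IHy IHy'.
  have sat0 : is_minor set0 (set0 : {set edges G}) set0.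
    exact: is_minor_sub (sub0set _) (is_minor_inside setT (saturated0 _)).
  rewrite (m_empty (set0 : {set edges G})) (b_minorT G).
  split; rewrite mu_m ?is_minorT ?set0U ?setU0 //.
    by rewrite -setI_eq0 set0I.
  by rewrite -setI_eq0 setI0.
elim/b_ind: x => [|a x x' IHx IHx'|G gG].
- by rewrite !linear0l linear0 linear0l linear0.
- by rewrite !(tensPl, linearP) /= IHx IHx'.
elim/b_ind: y => [|a y y' IHy IHy'|G' gG'].
- by rewrite !(linear0l, linear0r, linear0).
- by rewrite !(tensPl, tensPr, linearP) /= IHy IHy'.
elim/b_ind: z => [|a z z' IHz IHz'|G'' gG''].
- by rewrite !(linear0l, linear0r, linear0).
- by rewrite !(tensPr, linearP) /= IHz IHz'.
rewrite !muE //; do ?exact: no_empty_edge_hunion.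
apply: b_hiso; exact: hiso_hunionA.
Qed.

Lemma b_Delta_coalgebra : counital_coalgebra Delta epsD.
Proof.
split=> x.
  move: x; apply: (b_ext (f := @tassoc _ _ _ _ \o (tmap Delta idfun \o Delta))
    (g := tmap idfun Delta \o Delta)) => G gG /=.
  rewrite (b_minorT G) Delta_m0 ?is_minorT // !tensor_sumE /=.
  (* A restriction of a restriction depends on the smaller vertex set only. Hence both iterated
     coproducts sum products of [M] over the three blocks of an ordered partition of the
     vertices. *)
  pose M (C : {set verts G}) := m set0 (inside [set: edges G] C) C.
  transitivity (\sum_(C : {set verts G} | C \subset setT)
      \sum_(D : {set verts G} | D \subset C)
        M D \ox (M (C :\: D) \ox M (setT :\: C))).
    apply: eq_bigr => C _; rewrite tmapE /= Delta_m0 //; last first.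
      exact: is_minor_inside _ (saturated0 _).
    rewrite tens_suml tassoc_sum; apply: eq_bigr => D sDC /=.
    by rewrite tassocE !inside_inside // subsetDl.
  rewrite (big_subset_flag _ (fun D E R => M D \ox (M E \ox M R))).
  apply: eq_bigr => D _; rewrite tmapE /= Delta_m0 //; last first.
    exact: is_minor_inside _ (saturated0 _).
  rewrite tens_sumr; apply: eq_bigr => E sE.
  by rewrite !inside_inside // subsetDl.
have mI (G : hypergraph) (C : {set verts G}) :
    is_minor set0 (inside [set: edges G] C) C.
  exact: is_minor_inside _ (saturated0 _).
split; move: x.
  apply: (b_ext (f := @tunitl _ _ \o (tmap epsD idfun \o Delta)) (g := idfun)) => G gG /=.
  rewrite (b_minorT G) Delta_m0 ?is_minorT // !tensor_sumE /=.
  under eq_bigr => C _ do rewrite tmapE tunitlE /= epsD_m //.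
  by rewrite sum_indicator ?sub0set // setD0 insideT.
apply: (b_ext (f := @tunitr _ _ \o (tmap idfun epsD \o Delta)) (g := idfun)) => G gG /=.
rewrite (b_minorT G) Delta_m0 ?is_minorT // !tensor_sumE /=.
under eq_bigr => C sC.
  rewrite tmapE tunitrE /= epsD_m // setTD_eq0.
over.
by rewrite sum_indicator ?subxx // insideT.
Qed.

Lemma b_delta_coalgebra : counital_coalgebra delta epsd.
Proof.
split=> x.
  move: x; apply: (b_ext (f := @tassoc _ _ _ _ \o (tmap delta idfun \o delta))
    (g := tmap idfun delta \o delta)) => G gG /=.
  have mT := is_minorT G.
  rewrite (b_minorT G) delta_m // !tensor_sumE /=.
  (* For an ordered partition of the edges into three blocks, the first factor keeps the first
     block, the second contracts it and keeps the second block, and the third contracts both and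
     keeps the rest. *)
  transitivity (\sum_(C : {set edges G} | C \subset setT)
      \sum_(D : {set edges G} | D \subset C)
        m set0 D setT \ox (m D (C :\: D) setT \ox m (D :|: (C :\: D)) (setT :\: C) setT)).
    apply: eq_bigr => C sC; rewrite tmapE /= delta_m //; last first.
      exact: is_minor_sub mT.
    rewrite tens_suml tassoc_sum; apply: eq_bigr => D sDC /=.
    by rewrite tassocE !set0U setDUK.
  rewrite (big_subset_flag _ (fun D E R =>
    m set0 D setT \ox (m D E setT \ox m (D :|: E) R setT))).
  apply: eq_bigr => D sD; rewrite tmapE /= delta_m //; last first.
    exact: is_minor_contract mT.
  by rewrite tens_sumr; apply: eq_bigr => E sE; rewrite !set0U.
split; move: x.
  apply: (b_ext (f := @tunitl _ _ \o (tmap epsd idfun \o delta)) (g := idfun)) => G gG /=.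
  have mT := is_minorT G; rewrite (b_minorT G) delta_m // !tensor_sumE /=.
  under eq_bigr => D sD.
    rewrite tmapE tunitlE /= epsd_m //; last exact: is_minor_sub mT.
  over.
  by rewrite sum_indicator ?sub0set // setD0 setU0.
apply: (b_ext (f := @tunitr _ _ \o (tmap idfun epsd \o delta)) (g := idfun)) => G gG /=.
have mT := is_minorT G; rewrite (b_minorT G) delta_m // !tensor_sumE /=.
under eq_bigr => D sD.
  rewrite tmapE tunitrE /= epsd_m //; last exact: is_minor_contract mT.
  rewrite setTD_eq0.
over.
by rewrite sum_indicator ?subxx.
Qed.

Lemma coproduct_hempty (I : finType) (f : {set I} -> B ⊗ B) : #|I| = 0%N ->
  \sum_(A : {set I}) f A = f set0.
Proof.
move=> I0; rewrite (big_pred1 set0) // => A; apply/esym/eqP/setP => x.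
by have := card0_eq I0 x; rewrite inE.
Qed.

Lemma no_empty_edge_hempty : no_empty_edge hempty. Proof. by case. Qed.

Lemma b_Delta_eta : Delta (eta 1) = eta 1 \ox eta 1.
Proof.
rewrite etaE DeltaE; last exact: no_empty_edge_hempty.
rewrite coproduct_hempty ?card_void //.
by congr (_ \ox _); apply: b_hiso; apply: hiso_empty; rewrite ?card_void //;
  apply: eq_card0 => -[[]].
Qed.

Lemma b_delta_eta : delta (eta 1) = eta 1 \ox eta 1.
Proof.
rewrite etaE deltaE; last exact: no_empty_edge_hempty.
rewrite coproduct_hempty ?card_void //.
by congr (_ \ox _); apply: b_hiso; apply: hiso_empty; rewrite ?card_void //;
  apply: eq_card0 => -[e He]; first [by have [] : void := e | by have /imsetP[[]] := He].
Qed.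

(** A vertex set of the product splits uniquely along [U1] and [U2], and restriction respects the
    splitting because each edge stays on the side of its own factor. *)
Lemma Delta_mu_m (G : hypergraph) (A1 A2 : {set edges G}) (U1 U2 : {set verts G}) :
  no_empty_edge G -> [disjoint U1 & U2] ->
  is_minor set0 A1 U1 -> is_minor set0 A2 U2 ->
  Delta (mu (m set0 A1 U1 \ox m set0 A2 U2)) =
  tmap mu mu (tinter (Delta (m set0 A1 U1) \ox Delta (m set0 A2 U2))).
Proof.
move=> gX dU m1' m2'.
have [[_ AU1] [_ AU2]] := (is_minorP m1', is_minorP m2').
rewrite mu_m // !Delta_m0 //; last exact: is_minorU.
rewrite big_subsetU // tens_suml !tensor_sumE /=; apply: eq_bigr => C1 sC1.
rewrite tens_sumr !tensor_sumE /=; apply: eq_bigr => C2 sC2.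
have mI A C : is_minor set0 (inside A C) C by apply: is_minor_inside _ (saturated0 _).
rewrite tinterE tmapE !mu_m //; last first.
- exact: disjointW sC1 sC2 dU.
- by apply: disjointW dU; rewrite subsetDl.
by rewrite setDUU // !(inside_union dU) ?subsetDl.
Qed.

Lemma b_Delta_mu x y :
  Delta (mu (x \ox y)) = tmap mu mu (tinter (Delta x \ox Delta y)).
Proof.
rewrite -tmapE; move: x y.
apply: (b_ext2 (f := Delta \o mu)
  (g := tmap mu mu \o (@tinter _ _ _ _ _ \o tmap Delta Delta))) => G G' gG gG' /=.
rewrite tmapE (minor_of_b (minor_of_inl G G')) (minor_of_b (minor_of_inr G G')).
apply: Delta_mu_m; first exact: no_empty_edge_hunion.
- exact: disjoint_inl_inr.
- exact: minor_of_is_minor (minor_of_inl G G').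
- exact: minor_of_is_minor (minor_of_inr G G').
Qed.

Lemma delta_mu_m (G : hypergraph) (A1 A2 : {set edges G}) (U1 U2 : {set verts G}) :
  no_empty_edge G -> [disjoint U1 & U2] ->
  is_minor set0 A1 U1 -> is_minor set0 A2 U2 ->
  delta (mu (m set0 A1 U1 \ox m set0 A2 U2)) =
  tmap mu mu (tinter (delta (m set0 A1 U1) \ox delta (m set0 A2 U2))).
Proof.
move=> gX dU m1' m2'.
have [[_ AU1] [_ AU2]] := (is_minorP m1', is_minorP m2').
have dA : [disjoint A1 & A2] := no_empty_edge_disjoint gX dU AU1 AU2.
rewrite mu_m // !delta_m //; last exact: is_minorU.
rewrite big_subsetU // tens_suml !tensor_sumE /=; apply: eq_bigr => D1 sD1.
rewrite tens_sumr !tensor_sumE /=; apply: eq_bigr => D2 sD2.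
rewrite tinterE tmapE mu_m //; [|exact: is_minor_sub m1'|exact: is_minor_sub m2'].
congr (_ \ox _); rewrite setDUU //.
have mc1 := is_minor_contract sD1 m1'; have mc2 := is_minor_contract sD2 m2'.
(* The right-hand factors contract [D1] and [D2] respectively, but [mu_m] needs one contracted set.
   Each of these sets avoids the vertices of the other factor, so both contracted sets can be
   enlarged to [D1 :|: D2]. *)
have D1U e : e \in D1 -> inc e \subset ~: U2.
  move=> /(subsetP sD1)/AU1 sub; apply: subset_trans sub _.
  by rewrite -disjoints_subset.
have D2U e : e \in D2 -> inc e \subset ~: U1.
  move=> /(subsetP sD2)/AU2 sub; apply: subset_trans sub _.
  by rewrite -disjoints_subset disjoint_sym.
rewrite -(m_setUl mc1 D2U) -(m_setUl mc2 D1U) -!setUA (setUC D2 D1) mu_m //.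
- by rewrite setUA; apply: minor_of_is_minor (minor_of_setUl D2U (minorP mc1)).
- rewrite (setUC D1 D2) setUA.
  exact: minor_of_is_minor (minor_of_setUl D1U (minorP mc2)).
Qed.

Lemma b_delta_mu x y :
  delta (mu (x \ox y)) = tmap mu mu (tinter (delta x \ox delta y)).
Proof.
rewrite -tmapE; move: x y.
apply: (b_ext2 (f := delta \o mu)
  (g := tmap mu mu \o (@tinter _ _ _ _ _ \o tmap delta delta))) => G G' gG gG' /=.
rewrite tmapE (minor_of_b (minor_of_inl G G')) (minor_of_b (minor_of_inr G G')).
apply: delta_mu_m; first exact: no_empty_edge_hunion.
- exact: disjoint_inl_inr.
- exact: minor_of_is_minor (minor_of_inl G G').
- exact: minor_of_is_minor (minor_of_inr G G').
Qed.

Lemma b_epsD_mu x y : epsD (mu (x \ox y)) = epsD x * epsD y.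
Proof.
transitivity (tunitl (tmap epsD epsD (x \ox y))); last by rewrite tmapE tunitlE.
move: x y; apply: (b_ext2 (f := epsD \o mu)
  (g := @tunitl _ _ \o tmap epsD epsD)) => G G' gG gG' /=.
rewrite tmapE tunitlE muE // !epsDE //; last exact: no_empty_edge_hunion.
by rewrite card_sum addn_eq0 /GRing.scale /= -natrM mulnb.
Qed.

Lemma b_epsd_mu x y : epsd (mu (x \ox y)) = epsd x * epsd y.
Proof.
transitivity (tunitl (tmap epsd epsd (x \ox y))); last by rewrite tmapE tunitlE.
move: x y; apply: (b_ext2 (f := epsd \o mu)
  (g := @tunitl _ _ \o tmap epsd epsd)) => G G' gG gG' /=.
rewrite tmapE tunitlE muE // !epsdE //; last exact: no_empty_edge_hunion.
by rewrite card_sum addn_eq0 /GRing.scale /= -natrM mulnb.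
Qed.

Lemma b_cointeraction_counit x :
  tunitr (tmap idfun epsD (delta x)) = eta (epsD x).
Proof.
move: x; apply: (b_ext (f := @tunitr _ _ \o (tmap idfun epsD \o delta))
  (g := eta \o epsD)) => G gG /=.
have mT := is_minorT G.
have -> : eta (epsD (b G)) = epsD (b G) *: b hempty.
  by rewrite -etaE -linearZ /=; congr (eta _); apply/esym/mulr1.
rewrite (b_minorT G) delta_m // !tensor_sumE epsD_m //=.
under eq_bigr => D sD.
  rewrite tmapE tunitrE /= epsD_m //; last exact: is_minor_contract mT.
over.
(* A quotient of a non-empty vertex set is non-empty, so both sides vanish when there are vertices.
   Without vertices there are no edges either, as none is empty, and the only term left is the
   unit. *)
have [T0|_] := eqVneq [set: verts G] set0; last first.
  by rewrite scale0r big1 // => D _; rewrite scale0r.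
have E0 : [set: edges G] = set0.
  apply/setP => e; rewrite !inE; have /set0Pn[v _] := gG e.
  by have := in_setT v; rewrite T0 inE.
rewrite T0 E0 scale1r (big_pred1 set0) => [|D]; last by rewrite /= subset0.
by rewrite scale1r -m_empty.
Qed.

Lemma b_cointeraction x :
  tmap idfun Delta (delta x) = m13_2_4 mu (tmap delta delta (Delta x)).
Proof.
rewrite /m13_2_4; move: x; apply: (b_ext (f := tmap idfun Delta \o delta)
  (g := tmap mu idfun \o (@tinter _ _ _ _ _ \o (tmap delta delta \o Delta)))) => G gG /=.
have mT := is_minorT G.
rewrite (b_minorT G) delta_m // Delta_m0 // !tensor_sumE /=.
pose f (C : {set verts G}) (D : {set edges G}) :=
  m set0 D setT \ox
  (m D (inside (setT :\: D) C) C \ox m D (inside (setT :\: D) (setT :\: C)) (setT :\: C)).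
(* Both sides sum over pairs where no edge of [D] crosses [C]. On the left [D] is contracted first
   and [C] is then a union of its classes; on the right the vertices are cut along [C] first and [D]
   is then chosen on each side. *)
transitivity (\sum_(C : {set verts G}) \sum_(D : {set edges G} | saturated D C) f C D).
  rewrite (exchange_big_dep (fun D : {set edges G} => D \subset setT)) /=; last first.
    by move=> C D _ _; apply: subsetT.
  apply: eq_bigr => D sD; rewrite tmapE /= Delta_m //; last exact: is_minor_contract mT.
  rewrite tens_sumr !set0U; apply: eq_bigl => C.
  by rewrite subsetT.
apply: eq_big => [C|C _]; first by rewrite subsetT.
have dC : [disjoint C & setT :\: C] by rewrite -setI_eq0 setTD setICr.
under eq_bigl => D do rewrite saturated_inside //.
have mI : forall C, is_minor set0 (inside [set: edges G] C) C.
  by move=> C'; apply: is_minor_inside _ (saturated0 _).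
have [_ sI] := is_minorP (mI C); have [_ sI'] := is_minorP (mI (setT :\: C)).
rewrite big_subsetU; last exact: no_empty_edge_disjoint sI sI'.
rewrite tmapE /= !delta_m // tens_suml !tensor_sumE /=; apply: eq_bigr => D1 sD1.
rewrite tens_sumr !tensor_sumE /=; apply: eq_bigr => D2 sD2.
have [m1 m2] := (is_minor_sub sD1 (mI C), is_minor_sub sD2 (mI (setT :\: C))).
rewrite tinterE tmapE /= mu_m // !set0U.
have -> : C :|: (setT :\: C) = setT by rewrite setTD setUCr.
have [[_ s1] [_ s2]] := (is_minorP m1, is_minorP m2).
congr (_ \ox (_ \ox _)).
  (* The part inside [C] has contracted only [D1]; contracting [D2] as well changes nothing there.
     The remaining edges agree because an edge of [D2] lying inside [C] would be empty. *)
  rewrite -(m_setUl (F' := D2) _ (F := D1)); last 2 first.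
  - by have := is_minor_contract sD1 (mI C); rewrite set0U.
  - by move=> e /s2; rewrite setTD.
  congr (b (minor _ _ _)); apply/setP => e; rewrite !inE /= !andbT.
  case eC: (inc e \subset C); rewrite ?andbT ?andbF //.
  rewrite negb_or; apply: andb_idr => _; apply/negP => /s2 eC'.
  have /set0Pn[v ve] := gG e.
  by have := subsetP eC' v ve; rewrite !inE (subsetP eC v ve).
rewrite (setUC D1) -(m_setUl (F' := D1) _ (F := D2)); last 2 first.
- by have := is_minor_contract sD2 (mI (setT :\: C)); rewrite set0U.
- by move=> e /s1; rewrite setTD setCK.
congr (b (minor _ _ _)); apply/setP => e; rewrite !inE /= !andbT.
case eC: (inc e \subset _ :\: C); rewrite ?andbT ?andbF //.
rewrite negb_or; apply: andb_idr => _; apply/negP => /s1 eC'.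
have /set0Pn[v ve] := gG e.
by have := subsetP eC v ve; rewrite !inE (subsetP eC' v ve).
Qed.

Lemma b_double_bialgebra : double_bialgebra mu eta Delta epsD delta epsd.
Proof.
split.
- split; [exact: b_unital_algebra | exact: b_Delta_coalgebra | split | split].
  + exact: b_Delta_eta.
  + exact: b_Delta_mu.
  + by rewrite etaE epsDE ?card_void //; apply: no_empty_edge_hempty.
  + exact: b_epsD_mu.
- split; [exact: b_unital_algebra | exact: b_delta_coalgebra | split | split].
  + exact: b_delta_eta.
  + exact: b_delta_mu.
  + by rewrite etaE epsdE ?card_void //; apply: no_empty_edge_hempty.
  + exact: b_epsd_mu.
- exact: b_cointeraction_counit.
- exact: b_cointeraction.
Qed.

End Formulas.

(** * Transport to complements and duals *)

Section Isomorphisms.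
Implicit Types G : hypergraph.

(** The membership form is symmetric in edges and vertices, so dualizing an isomorphism just
    exchanges its two bijections. *)
Lemma hisoP G G' (f : edges G -> edges G') (g : verts G -> verts G') :
  bijective f -> bijective g ->
  (forall e v, (g v \in inc (f e)) = (v \in inc e)) -> hiso G G'.
Proof.
move=> bf bg fg; exists f, g; split=> // e; apply/setP => v.
case: bg => g' gK g'K; rewrite -(g'K v) fg mem_imset //; exact: can_inj gK.
Qed.

Lemma hiso_mem G G' : hiso G G' ->
  exists (f : edges G -> edges G') (g : verts G -> verts G'),
  [/\ bijective f, bijective g & forall e v, (g v \in inc (f e)) = (v \in inc e)].
Proof.
move=> [f [g [bf bg fg]]]; exists f, g; split=> // e v.
by rewrite fg mem_imset //; apply: bij_inj.
Qed.

Lemma hiso_hcompl G G' : hiso G G' -> hiso (hcompl G) (hcompl G').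
Proof.
move=> /hiso_mem[f [g [bf bg fg]]]; apply: (@hisoP (hcompl G) (hcompl G') f g) => // e v.
by rewrite !inE fg.
Qed.

Lemma hiso_hdual G G' : hiso G G' -> hiso (hdual G) (hdual G').
Proof.
move=> /hiso_mem[f [g [bf bg fg]]]; apply: (@hisoP (hdual G) (hdual G') g f) => // v e.
by rewrite !inE fg.
Qed.

Lemma hcomplK G : hiso (hcompl (hcompl G)) G.
Proof.
by apply: (@hisoP (hcompl (hcompl G)) G id id) => [||e v];
  [exists id | exists id | rewrite !inE negbK].
Qed.

Lemma hdualK G : hiso (hdual (hdual G)) G.
Proof.
by apply: (@hisoP (hdual (hdual G)) G id id) => [||e v];
  [exists id | exists id | rewrite !inE].
Qed.

Lemma hdual_hcompl G : hiso (hdual (hcompl G)) (hcompl (hdual G)).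
Proof.
by apply: (@hisoP (hdual (hcompl G)) (hcompl (hdual G)) id id) => [||e v];
  [exists id | exists id | rewrite !inE].
Qed.

Lemma sum_map_bij (S S' T T' : Type) (f : S -> T) (f' : S' -> T') :
  bijective f -> bijective f' ->
  bijective (fun x : S + S' => match x with
    inl y => inl (f y) | inr y => inr (f' y) end : T + T').
Proof.
move=> [g fK gK] [g' f'K g'K].
exists (fun x => match x with inl y => inl (g y) | inr y => inr (g' y) end).
  by case=> x; rewrite ?fK ?f'K.
by case=> x; rewrite ?gK ?g'K.
Qed.

Lemma hiso_hunion G1 G2 G1' G2' :
  hiso G1 G1' -> hiso G2 G2' -> hiso (hunion G1 G2) (hunion G1' G2').
Proof.
move=> /hiso_mem[f [g [bf bg fg]]] /hiso_mem[f' [g' [bf' bg' fg']]].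
apply: (@hisoP (hunion G1 G2) (hunion G1' G2')
  _ _ (sum_map_bij bf bf') (sum_map_bij bg bg')).
by case=> [e|e] [v|v] /=; rewrite !mem_sumE.
Qed.

Lemma hdual_hunion G G' :
  hiso (hdual (hunion G G')) (hunion (hdual G) (hdual G')).
Proof.
apply: (@hisoP (hdual (hunion G G')) (hunion (hdual G) (hdual G')) id id).
- by exists id.
- by exists id.
by case=> [v|v] [e|e] /=; rewrite !(mem_sumE, inE).
Qed.

Lemma hrepr_hiso G : hiso (hrepr (hclass_of G)) G.
Proof. by apply/hclassP; rewrite hreprK. Qed.

Lemma hiso_card_edges G G' : hiso G G' -> #|edges G| = #|edges G'|.
Proof. by case=> f [g [bf _ _]]; apply: bij_eq_card bf. Qed.

Lemma hiso_card_verts G G' : hiso G G' -> #|verts G| = #|verts G'|.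
Proof. by case=> f [g [_ bg _]]; apply: bij_eq_card bg. Qed.

End Isomorphisms.

(** * The operations of [H] on isomorphism classes *)

Section BasisFormulas.
Variable K : fieldType.

Lemma hg_hiso G G' : hiso G G' -> hg K G = hg K G'.
Proof. by move=> /hclassP GG'; rewrite /hg GG'. Qed.

Lemma c_map_hg G : c_map (hg K G) = hg K (hcompl G).
Proof. by rewrite /c_map linextU; apply/hg_hiso/hiso_hcompl/hrepr_hiso. Qed.

Lemma d_map_hg G : d_map (hg K G) = hg K (hdual G).
Proof. by rewrite /d_map linextU; apply/hg_hiso/hiso_hdual/hrepr_hiso. Qed.

Lemma mu_H_hg G G' : mu_H (hg K G \ox hg K G') = hg K (hunion G G').
Proof.
rewrite /mu_H tliftE /= /hmul !linextU.
by apply/hg_hiso/hiso_hunion; apply: hrepr_hiso.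
Qed.

(** Independence of the representative: the chosen representative and [G] itself are minors of [G]
    for the same three sets, and [sum_hrestr] expresses both sums through these sets alone. *)
Lemma Delta_H_hg G : Delta_H (hg K G) =
  \sum_(U : {set verts G}) hg K (hrestr U) \ox hg K (hrestr (~: U)).
Proof.
rewrite /Delta_H linextU; have [i [q mX]] := minor_of_id (hiso_sym (hrepr_hiso G)).
have [j [r mG]] := minor_of_id (hiso_refl G).
by rewrite (sum_hrestr hg_hiso mX) (sum_hrestr hg_hiso mG).
Qed.

Lemma delta_H_hg G : no_empty_edge G -> delta_H (hg K G) =
  \sum_(F : {set edges G}) hg K (hsub F) \ox hg K (hcontract F).
Proof.
move=> gG; rewrite /delta_H linextU.
have isoG := hiso_sym (hrepr_hiso G); have [i [q mX]] := minor_of_id isoG.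
have [j [r mG]] := minor_of_id (hiso_refl G).
rewrite (sum_hcontract hg_hiso mG) -(sum_hcontract hg_hiso mX).
apply: eq_bigl => F; apply/subsetP => e _.
by rewrite inE (no_empty_edge_hiso isoG).
Qed.

Lemma eps_verts_hg G : eps_verts (hg K G) = (#|verts G| == 0)%N%:R.
Proof. by rewrite /eps_verts linextU (hiso_card_verts (hrepr_hiso G)). Qed.

Lemma eps_edges_hg G : eps_edges (hg K G) = (#|edges G| == 0)%N%:R.
Proof. by rewrite /eps_edges linextU (hiso_card_edges (hrepr_hiso G)). Qed.

Lemma eta_H_is_linear : linear (@eta_H K).
Proof. by move=> a x y; rewrite /eta_H scalerDl scalerA. Qed.

HB.instance Definition _ :=
  GRing.isLinear.Build K K^o (H K) *:%R (@eta_H K) eta_H_is_linear.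
HB.instance Definition _ := GRing.Linear.on (@mu_c K).
HB.instance Definition _ := GRing.Linear.on (@Delta_c K).
HB.instance Definition _ := GRing.Linear.on (@delta_c K).
HB.instance Definition _ := GRing.Linear.on (@Delta_cd K).
HB.instance Definition _ := GRing.Linear.on (@delta_cd K).

End BasisFormulas.

(** * Restricting the operations to a spanned subspace *)

Section SpanRetraction.
Variables (K : fieldType) (I : choiceType) (P : {malg K[I]} -> Prop).
Local Notation S := (spanned P).

Lemma spanned_ind (Q : S -> Prop) : Q 0 ->
  (forall a x y, Q x -> Q y -> Q (a *: x + y)) ->
  (forall v (Pv : P v), Q (Span (span_gen Pv))) -> forall x, Q x.
Proof.
move=> Q0 Qlin QP x; have /span_predP[n [a [v [Pv xE]]]] := span_valP x.
have -> : x = \sum_(i < n) a i *: Span (span_gen (Pv i)).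
  by apply: val_inj; rewrite raddf_sum; apply: etrans xE _.
by elim/big_rec: _ => // i y _; apply: Qlin.
Qed.

(** Basis elements outside the span go to the default [0], which gives a linear map on the whole
    space. Restricted operations can then be defined by composition with it, and that nothing is
    lost is checked on generators afterwards. *)
Definition span_retract : {malg K[I]} -> S :=
  linext (fun i => insubd (0 : S) << i >>).
HB.instance Definition _ := GRing.Linear.on span_retract.

Lemma span_retract_gen i : P << i >> -> span_val (span_retract << i >>) = << i >>.
Proof. by move=> /span_gen Pi; rewrite /span_retract linextU insubdK. Qed.

End SpanRetraction.

Section Transport.
Variables (K : fieldType) (S : lmodType K) (theta : hypergraph -> hypergraph).
Variables (incl : {linear S -> H K}) (p : {linear H K -> S}).
Variables (mu' : {linear H K ⊗ H K -> H K}).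
Variables (Delta' delta' : {linear H K -> H K ⊗ H K}).
Variables (epsD epsd : {linear H K -> K^o}).

Local Notation hgt G := (hg K (theta G)).

Hypothesis theta_hiso : forall G G', hiso G G' -> hiso (theta G) (theta G').
Hypothesis theta_hempty : hiso (theta hempty) hempty.
Hypothesis incl_p : forall G, no_empty_edge G -> incl (p (hgt G)) = hgt G.
Hypothesis S_ind : forall Q : S -> Prop, Q 0 ->
  (forall a x y, Q x -> Q y -> Q (a *: x + y)) ->
  (forall G, no_empty_edge G -> Q (p (hgt G))) -> forall x, Q x.
Hypothesis mu'E : forall G G', mu' (hgt G \ox hgt G') = hgt (hunion G G').
Hypothesis Delta'E : forall G, no_empty_edge G -> Delta' (hgt G) =
  \sum_(U : {set verts G}) hgt (hrestr U) \ox hgt (hrestr (~: U)).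
Hypothesis delta'E : forall G, no_empty_edge G -> delta' (hgt G) =
  \sum_(F : {set edges G}) hgt (hsub F) \ox hgt (hcontract F).
(** The vertices counted are those of [G], not of [theta G]. When [theta] dualizes, they are the
    edges of [theta G], which is why the two counits trade places for [H^cd]. *)
Hypothesis epsDE : forall G, epsD (hgt G) = (#|verts G| == 0)%N%:R.
Hypothesis epsdE : forall G, epsd (hgt G) = (#|edges G| == 0)%N%:R.

Lemma transport_mu : exists mu : {linear S ⊗ S -> S},
  forall G G', no_empty_edge G -> no_empty_edge G' ->
    mu (p (hgt G) \ox p (hgt G')) = p (hgt (hunion G G')).
Proof.
exists (p \o (mu' \o tmap incl incl)) => G G' gG gG'.
by rewrite [LHS]/= (tmapE incl incl) (incl_p gG) (incl_p gG') mu'E.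
Qed.

Lemma transport_eta : exists eta : {linear K^o -> S},
  eta 1 = p (hgt hempty) /\ forall a, incl (eta a) = eta_H a.
Proof.
have -> : hgt hempty = hg K hempty by apply: hg_hiso.
exists (p \o @eta_H K); rewrite /= /eta_H scale1r; split=> // a.
by rewrite !linearZ /= -(hg_hiso K theta_hempty) incl_p.
Qed.

(** Treats both coproducts at once: all that matters is that the left and right factors again have
    no empty edge, so that every term lies in the tensor square of the subspace. *)
Lemma transport_coproduct (D : {linear H K -> H K ⊗ H K})
    (I : hypergraph -> finType) (l r : forall G, I G -> hypergraph) :
  (forall G i, no_empty_edge G -> no_empty_edge (l G i)) ->
  (forall G i, no_empty_edge G -> no_empty_edge (r G i)) ->
  (forall G, no_empty_edge G ->
     D (hgt G) = \sum_(i : I G) hgt (l G i) \ox hgt (r G i)) ->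
  exists D' : {linear S -> S ⊗ S},
    (forall x, tmap incl incl (D' x) = D (incl x)) /\
    (forall G, no_empty_edge G ->
      D' (p (hgt G)) = \sum_(i : I G) p (hgt (l G i)) \ox p (hgt (r G i))).
Proof.
move=> gl gr DE.
have [D' D'E] : exists D' : {linear S -> S ⊗ S}, forall G, no_empty_edge G ->
    D' (p (hgt G)) = \sum_(i : I G) p (hgt (l G i)) \ox p (hgt (r G i)).
  exists (tmap p p \o (D \o incl)) => G gG.
  rewrite [LHS]/= (incl_p gG) (DE G gG) tmap_sum.
  by apply: eq_bigr => i _; rewrite tmapE.
exists D'; split=> //.
apply: (b_ext S_ind (f := tmap incl incl \o D') (g := D \o incl)) => G gG.
rewrite [LHS]/= [RHS]/= (D'E G gG) tmap_sum (incl_p gG) (DE G gG).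
by apply: eq_bigr => i _; rewrite tmapE (incl_p (gl G i gG)) (incl_p (gr G i gG)).
Qed.

Lemma transport_double_bialgebra :
  exists (mu : {linear S ⊗ S -> S}) (eta : {linear K^o -> S})
         (Delta delta : {linear S -> S ⊗ S}),
    [/\ forall t, incl (mu t) = mu' (tmap incl incl t),
        forall a, incl (eta a) = eta_H a,
        forall x, tmap incl incl (Delta x) = Delta' (incl x),
        forall x, tmap incl incl (delta x) = delta' (incl x)
      & double_bialgebra mu eta Delta (epsD \o incl) delta (epsd \o incl)].
Proof.
have [mu muE] := transport_mu; have [eta [eta1 etaE]] := transport_eta.
have [Delta [inclDelta DeltaE]] := transport_coproduct
  (fun G U => @no_empty_edge_hrestr G U)
  (fun G U => @no_empty_edge_hrestr G (~: U)) Delta'E.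
have [delta [incldelta deltaE]] := transport_coproduct
  (fun G F => @no_empty_edge_hsub G F)
  (fun G F => @no_empty_edge_hcontract G F) delta'E.
exists mu, eta, Delta, delta; split=> //.
- apply: (tensor_ext (f := incl \o mu) (g := mu' \o tmap incl incl)).
  apply: (b_ext2 S_ind (f := incl \o mu)
    (g := mu' \o tmap incl incl)) => G G' gG gG'.
  rewrite [LHS]/= [RHS]/= tmapE (incl_p gG) (incl_p gG') mu'E (muE G G' gG gG').
  exact: incl_p (no_empty_edge_hunion gG gG').
apply: (b_double_bialgebra (b := fun G => p (hgt G))).
- by move=> G G' /theta_hiso GG'; rewrite (hg_hiso K GG').
- exact: S_ind.
- exact: muE.
- exact: eta1.
- exact: DeltaE.
- exact: deltaE.
- by move=> G gG; rewrite [LHS]/= (incl_p gG) epsDE.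
- by move=> G gG; rewrite [LHS]/= (incl_p gG) epsdE.
Qed.

End Transport.

Section TransportSpanned.
Variables (K : fieldType) (theta : hypergraph -> hypergraph).
Variable P : hypergraph -> Prop.
Local Notation gens := (fun x : H K => exists G, P G /\ x = hg K G).
Local Notation p := (@span_retract K hclass gens).

Hypothesis P_theta : forall G, no_empty_edge G -> P (theta G).
Hypothesis theta_P : forall G, P G -> exists G', no_empty_edge G' /\ hiso (theta G') G.

Lemma gens_incl_p G : no_empty_edge G ->
  span_val (p (hg K (theta G))) = hg K (theta G).
Proof.
by move=> gG; apply: span_retract_gen; exists (theta G); split; [apply: P_theta|].
Qed.

Lemma gens_ind (Q : spanned gens -> Prop) : Q 0 ->
  (forall a x y, Q x -> Q y -> Q (a *: x + y)) ->
  (forall G, no_empty_edge G -> Q (p (hg K (theta G)))) -> forall x, Q x.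
Proof.
move=> Q0 Qlin Qb; apply: spanned_ind => // v Pv.
have [G [PG vE]] := Pv; have [G' [gG' iso]] := theta_P PG.
suff -> : Span (span_gen Pv) = p (hg K (theta G')) by apply: Qb.
apply: val_inj; rewrite [RHS](gens_incl_p gG') (hg_hiso K iso); exact: vE.
Qed.

End TransportSpanned.

(** * The two cases: complements, and duals of complements *)

Section CoproductRestrictions.
Variable K : fieldType.

Definition no_full_edge G := ~ (exists e : edges G, forall v, v \in inc e).

Definition no_full_vertex G := ~ (exists v : verts G, forall e, v \in inc e).

Lemma hcompl_no_full_edge G : no_empty_edge G -> no_full_edge (hcompl G).
Proof.
by move=> gG [e full]; have /set0Pn[v ve] := gG e; have := full v; rewrite inE ve.
Qed.

Lemma no_full_edge_hcompl G : no_full_edge G ->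
  exists G', no_empty_edge G' /\ hiso (hcompl G') G.
Proof.
move=> nG; exists (hcompl G); split; last exact: hcomplK.
move=> e; apply/eqP => /= e0; apply: nG; exists e => v.
by have := in_set0 v; rewrite -e0 inE => /negbFE.
Qed.

Definition codual G := hdual (hcompl G).

(** A vertex of [codual G] is an edge of [G], and it lies on exactly those vertices of [G], now
    edges, that the original edge misses. It is full only if that edge is empty. *)
Lemma codual_no_full_vertex G : no_empty_edge G -> no_full_vertex (codual G).
Proof.
move=> gG [e full]; have /set0Pn[v ve] := gG e.
by have := full v; rewrite !inE ve.
Qed.

(** Complement and dual are commuting involutions up to isomorphism, hence so is their composite an
    involution. *)
Lemma codualK G : hiso (codual (codual G)) G.
Proof.
apply: hiso_trans (hdual_hcompl _) (hiso_trans _ (hcomplK G)).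
by apply: hiso_hcompl (hdualK _).
Qed.

Lemma no_full_vertex_codual G : no_full_vertex G ->
  exists G', no_empty_edge G' /\ hiso (codual G') G.
Proof.
move=> nG; exists (codual G); split; last exact: codualK.
move=> v; apply/eqP => /= v0; apply: nG; exists v => e.
by have := in_set0 e; rewrite -v0 !inE => /negbFE.
Qed.

Lemma codual_hiso G G' : hiso G G' -> hiso (codual G) (codual G').
Proof. by move=> /hiso_hcompl/hiso_hdual. Qed.

Lemma hiso_hcompl_hempty : hiso (hcompl hempty) hempty.
Proof. by apply: hiso_empty; rewrite card_void. Qed.

Lemma hiso_codual_hempty : hiso (codual hempty) hempty.
Proof. by apply: hiso_empty; rewrite card_void. Qed.

Lemma mu_c_hcompl G G' :
  mu_c (hg K (hcompl G) \ox hg K (hcompl G')) = hg K (hcompl (hunion G G')).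
Proof.
rewrite /mu_c /= tmapE /= !c_map_hg mu_H_hg c_map_hg.
by apply: hg_hiso; apply/hiso_hcompl/hiso_hunion; apply: hcomplK.
Qed.

Lemma mu_c_codual G G' :
  mu_c (hg K (codual G) \ox hg K (codual G')) = hg K (codual (hunion G G')).
Proof.
rewrite (hg_hiso K (hdual_hcompl G)) (hg_hiso K (hdual_hcompl G')) mu_c_hcompl.
apply: hg_hiso; apply: hiso_trans _ (hiso_sym (hdual_hcompl _)).
exact: hiso_hcompl (hiso_sym (hdual_hunion G G')).
Qed.

Lemma Delta_c_hcompl G : Delta_c (hg K (hcompl G)) =
  \sum_(U : {set verts G}) hg K (hcompl (hrestr U)) \ox hg K (hcompl (hrestr (~: U))).
Proof.
rewrite /Delta_c /= c_map_hg (hg_hiso K (hcomplK G)) Delta_H_hg tmap_sum.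
by apply: eq_bigr => U _; rewrite tmapE /= !c_map_hg.
Qed.

Lemma delta_c_hcompl G : no_empty_edge G -> delta_c (hg K (hcompl G)) =
  \sum_(F : {set edges G}) hg K (hcompl (hsub F)) \ox hg K (hcompl (hcontract F)).
Proof.
move=> gG; rewrite /delta_c /= c_map_hg (hg_hiso K (hcomplK G)) (delta_H_hg K gG).
by rewrite tmap_sum; apply: eq_bigr => F _; rewrite tmapE /= !c_map_hg.
Qed.

Lemma Delta_cd_codual G : Delta_cd (hg K (codual G)) =
  \sum_(U : {set verts G}) hg K (codual (hrestr U)) \ox hg K (codual (hrestr (~: U))).
Proof.
rewrite /Delta_cd /= c_map_hg d_map_hg (hg_hiso K (codualK G)) Delta_H_hg tmap_sum.
by apply: eq_bigr => U _; rewrite tmapE /= !c_map_hg !d_map_hg.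
Qed.

Lemma delta_cd_codual G : no_empty_edge G -> delta_cd (hg K (codual G)) =
  \sum_(F : {set edges G}) hg K (codual (hsub F)) \ox hg K (codual (hcontract F)).
Proof.
(* [delta_cd] applies the dual before the complement, whereas [codual] applies the complement first;
   the two orders agree up to isomorphism. *)
move=> gG; have iso : hiso (hcompl (hdual (codual G))) G.
  by apply: hiso_trans (codualK G); apply/hiso_sym/hdual_hcompl.
rewrite /delta_cd /= d_map_hg c_map_hg (hg_hiso K iso) (delta_H_hg K gG) tmap_sum.
apply: eq_bigr => F _; rewrite tmapE /= !d_map_hg !c_map_hg.
by rewrite -!(hg_hiso K (hdual_hcompl _)).
Qed.

End CoproductRestrictions.

Theorem mainTheorem4 (K : fieldType) :
  (exists (muc : {linear Hc K ⊗ Hc K -> Hc K}) (etac : {linear K^o -> Hc K})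
          (Deltac deltac : {linear Hc K -> Hc K ⊗ Hc K}),
     [/\ forall t, incl_c (muc t) = mu_c (tmap (@incl_c K) (@incl_c K) t),
         forall a, incl_c (etac a) = eta_H a,
         forall x, tmap (@incl_c K) (@incl_c K) (Deltac x) = Delta_c (incl_c x),
         forall x, tmap (@incl_c K) (@incl_c K) (deltac x) = delta_c (incl_c x)
       & double_bialgebra muc etac
           Deltac (@eps_verts K \o @incl_c K)
           deltac (@eps_edges K \o @incl_c K)]) /\
  (exists (mucd : {linear Hcd K ⊗ Hcd K -> Hcd K}) (etacd : {linear K^o -> Hcd K})
          (Deltacd deltacd : {linear Hcd K -> Hcd K ⊗ Hcd K}),
     [/\ forall t, incl_cd (mucd t) = mu_c (tmap (@incl_cd K) (@incl_cd K) t),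
         forall a, incl_cd (etacd a) = eta_H a,
         forall x,
           tmap (@incl_cd K) (@incl_cd K) (Deltacd x) = Delta_cd (incl_cd x),
         forall x,
           tmap (@incl_cd K) (@incl_cd K) (deltacd x) = delta_cd (incl_cd x)
       & double_bialgebra mucd etacd
           Deltacd (@eps_edges K \o @incl_cd K)
           deltacd (@eps_verts K \o @incl_cd K)]).
Proof.
split.
  pose p : {linear H K -> Hc K} := @span_retract K hclass _.
  apply: (transport_double_bialgebra (theta := hcompl) (incl := @incl_c K) (p := p)
    (mu' := @mu_c K) (Delta' := @Delta_c K) (delta' := @delta_c K)
    (epsD := @eps_verts K) (epsd := @eps_edges K)).
  - exact: hiso_hcompl.
  - exact: hiso_hcompl_hempty.
  - exact: gens_incl_p hcompl_no_full_edge.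
  - exact: gens_ind hcompl_no_full_edge no_full_edge_hcompl.
  - exact: mu_c_hcompl.
  - by move=> G _; apply: Delta_c_hcompl.
  - exact: delta_c_hcompl.
  - by move=> G; apply: eps_verts_hg.
  - by move=> G; apply: eps_edges_hg.
pose p : {linear H K -> Hcd K} := @span_retract K hclass _.
apply: (transport_double_bialgebra (theta := codual) (incl := @incl_cd K) (p := p)
  (mu' := @mu_c K) (Delta' := @Delta_cd K) (delta' := @delta_cd K)
  (epsD := @eps_edges K) (epsd := @eps_verts K)).
- exact: codual_hiso.
- exact: hiso_codual_hempty.
- exact: gens_incl_p codual_no_full_vertex.
- exact: gens_ind codual_no_full_vertex no_full_vertex_codual.
- exact: mu_c_codual.
- by move=> G _; apply: Delta_cd_codual.
- exact: delta_cd_codual.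
- by move=> G; apply: eps_edges_hg.
- by move=> G; apply: eps_verts_hg.
Qed.
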